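(* Let $X$ be a $2$-dimensional Banach space that is strictly convex and smooth but not absolutely smooth. Then $X$ has the Mazur--Ulam property.
   Context: Banach spaces are over the field of real numbers. For a Banach space $(X,\|\cdot\|)$, $S_X=\{x\in X:\|x\|=1\}$ denotes its unit sphere, equipped with the metric $(x,y)\mapsto\|x-y\|$. A Banach space $X$ has the Mazur--Ulam property if every isometry $f:S_X\to S_Y$ of $S_X$ onto the unit sphere $S_Y$ of an arbitrary Banach space $Y$ extends to a linear isometry of the Banach spaces $X,Y$ (i.e. a surjective linear isometry $X\to Y$ whose restriction to $S_X$ is $f$). A Banach space is strictly convex if any convex subset of its unit sphere contains at most one point. It is smooth if its unit ball has a unique supporting hyperplane at each point of the unit sphere. A $2$-dimensional Banach space $X$ is absolutely smooth if there exists a differentiable map $\mathbf r:\mathbb R\to S_X$ such that $\|\mathbf r'(s)\|=1$ for all $s\in\mathbb R$ and the derivative $\mathbf r':\mathbb R\to S_X$ is locally absolutely continuous. A function $f:U\to X$ from an open set $U\subseteq\mathbb R$ to a Banach space is absolutely continuous if for any $\varepsilon>0$ there exists $\delta>0$ such that for any points $x_1<y_1<x_2<y_2<\dots<x_n<y_n$ in $U$ with $\sum_{i=1}^n(y_i-x_i)<\delta$ we have $\sum_{i=1}^n\|f(y_i)-f(x_i)\|<\varepsilon$; it is locally absolutely continuous if every $s\in U$ has a neighborhood $O_s\subseteq U$ such that the restriction of $f$ to $O_s$ is absolutely continuous. *)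

(* Defs.v *)
From HB Require Import structures.
From mathcomp Require Import all_boot all_order all_algebra.
From mathcomp Require Import all_classical all_reals all_analysis.
Set Implicit Arguments.
Unset Strict Implicit.
Unset Printing Implicit Defensive.
Import Order.TTheory GRing.Theory Num.Theory.
Import numFieldNormedType.Exports.
Local Open Scope classical_set_scope.
Local Open Scope ring_scope.

(* [e] is a basis of [X]: every vector has unique coordinates along it. *)
Definition has_dimension (R : realType) (X : normedModType R) (n : nat) : Prop :=
  exists e : 'I_n -> X,
    forall x : X, exists! c : 'rV[R]_n, x = \sum_(i < n) c 0 i *: e i.

Definition unit_sphere (R : realType) (X : normedModType R) : set X :=
  [set x : X | `|x| = 1].

Definition unit_ball (R : realType) (X : normedModType R) : set X :=
  [set x : X | `|x| <= 1].

(* A map A -> B is represented by a total map, constrained only on A. *)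
Definition isometry_onto (R : realType) (X Y : normedModType R)
    (A : set X) (B : set Y) (f : X -> Y) : Prop :=
  f @` A = B /\
  forall x y : X, A x -> A y -> `|f x - f y| = `|x - y|.

Definition mazur_ulam_property (R : realType) (X : completeNormedModType R) :
    Prop :=
  forall (Y : completeNormedModType R) (f : X -> Y),
    isometry_onto (@unit_sphere R X) (@unit_sphere R Y) f ->
    exists F : {linear X -> Y},
      isometry_onto [set: X] [set: Y] F /\
      forall x : X, @unit_sphere R X x -> F x = f x.

Definition strictly_convex (R : realType) (X : normedModType R) : Prop :=
  forall C : set X, convex_set C -> C `<=` @unit_sphere R X ->
    forall x y : X, C x -> C y -> x = y.

(* Replacing (g, c) by (- g, - c) swaps the two sides of the hyperplane, so
   asking for [g <= c] on C loses nothing. *)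
Definition supporting_hyperplane (R : realType) (X : normedModType R)
    (C : set X) (x : X) (H : set X) : Prop :=
  H x /\
  exists (g : {linear X -> R^o}) (c : R),
    [/\ continuous g,
        (exists y : X, g y != 0),
        H = [set y : X | g y = c] &
        forall y : X, C y -> g y <= c].

Definition smooth_space (R : realType) (X : normedModType R) : Prop :=
  forall x : X, @unit_sphere R X x ->
    exists! H : set X, supporting_hyperplane (@unit_ball R X) x H.

(* The points a 0 < b 0 < a 1 < b 1 < ... < b (n - 1) must lie in U, but the
   intervals between them need not be included in U. *)
Definition abs_continuous_on (R : realType) (X : normedModType R)
    (U : set R) (f : R -> X) : Prop :=
  forall eps : R, 0 < eps ->
    exists2 delta : R, 0 < delta &
      forall (n : nat) (a b : nat -> R),
        (forall i, (i < n)%N -> [/\ U (a i), U (b i) & a i < b i]) ->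
        (forall i, (i.+1 < n)%N -> b i < a i.+1) ->
        \sum_(i < n) (b i - a i) < delta ->
        \sum_(i < n) `|f (b i) - f (a i)| < eps.

Definition locally_abs_continuous_on (R : realType) (X : normedModType R)
    (U : set R) (f : R -> X) : Prop :=
  forall s : R, U s ->
    exists O : set R,
      [/\ open_nbhs s O, O `<=` U & abs_continuous_on O f].

Definition absolutely_smooth (R : realType) (X : normedModType R) : Prop :=
  exists r : R -> X,
    [/\ forall s : R, @unit_sphere R X (r s),
        forall s : R, derivable r s 1,
        forall s : R, `|derive1 r s| = 1 &
        locally_abs_continuous_on [set: R] (derive1 r)].

(* Main.v *)
From HB Require Import structures.
Require Import Defs.
From mathcomp Require Import all_boot all_order all_algebra.
From mathcomp Require Import all_classical all_reals all_analysis.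
From mathcomp Require Import ring lra.
Set Implicit Arguments.
Unset Strict Implicit.
Unset Printing Implicit Defensive.
Import Order.TTheory GRing.Theory Num.Theory.
Import numFieldNormedType.Exports.
Local Open Scope classical_set_scope.
Local Open Scope ring_scope.

(* Write phi_u for the support functional at u, and call u quadratic if
   |u + h| <= |u| + phi_u(h) + O(|h|^2) as h -> 0.

   If every u <> 0 is quadratic, then u |-> phi_u is pointwise Lipschitz; along
   the polar parametrization of the sphere it is moreover locally monotone, hence
   locally absolutely continuous, and reparametrizing by arc length shows that X
   is absolutely smooth.

   So X has a unit vector p that is not quadratic: there are unit vectors x -> p
   with sigma = 1 - phi_p(x) much larger than |x - p|^2.  Let e span the kernel
   of phi_p and write x - p = tau e - sigma p, and likewise
   f(x) - f(p) = tau' e' - sigma' f(p).  For a unit vector s with p - s quadratic,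
   expanding |x - s| = |f(x) - f(s)| at x = p to second order in X and bounding
   the right-hand side below by convexity in Y gives an inequality between the
   values at (e, p) and (e', f(p)) of the support functionals at p - s and
   f(p) - f(s); if instead f(p) - f(s) is quadratic, the reverse inequality holds.
   Quadratic directions are dense, so by continuity both inequalities hold for all
   s; because sigma dominates |x - p|^2, this forces the two families of
   functionals to be intertwined by one linear map, which is then an isometry
   extending f. *)

(** * Support functionals *)

Section LinearForms.
Context {R : realType} {Z : normedModType R}.
Implicit Types (f : Z -> R) (u v w x y e : Z).

(** The two comparisons hold with constants and radii that depend on [s], and on two dense sets of
    [s] that may be disjoint, so they do not pass to all [s] as they stand; only relations free of
    these constants do. Let [alpha], [beta] be the values at [e], [p] in X, and [alpha'], [beta']
    those at [e'], [f p] in Y. At order [|x - p|] the comparisons give [alpha = alpha']. What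
    remains is [(tau - tau') alpha - sigma beta + sigma' beta'], up to [O(|x - p|^2)]. Its
    coefficients do not depend on [s] and the largest is at least [sigma]: dividing by it kills the
    error, and compactness yields one nontrivial linear relation valid for all [s]. The chord
    [s = - p] reduces it to [beta' = beta + k alpha], whence the map [e |-> e'], [p |-> f p - k e'].

    Y is an arbitrary space, yet the argument needs dimension two and a differentiable norm there as
    well. Both are read off the metric of the sphere: by strict convexity the isometry is odd, so
    norms of sums of unit vectors are distances too, and uniform convexity passes to Y, where it
    excludes corners. *)

Definition linear_form f := forall a x y, f (a *: x + y) = a * f x + f y.

Lemma linear_form0 f : linear_form f -> f 0 = 0.
Proof. by move=> lf; have := lf 1 0 0; rewrite scale1r addr0; lra. Qed.

Lemma linear_formZ f a x : linear_form f -> f (a *: x) = a * f x.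
Proof. by move=> lf; rewrite -[a *: x]addr0 lf linear_form0 // addr0. Qed.

Lemma linear_formD f x y : linear_form f -> f (x + y) = f x + f y.
Proof. by move=> lf; rewrite -[x in LHS]scale1r lf mul1r. Qed.

Lemma linear_formN f x : linear_form f -> f (- x) = - f x.
Proof. by move=> lf; rewrite -scaleN1r linear_formZ // mulN1r. Qed.

Lemma linear_formB f x y : linear_form f -> f (x - y) = f x - f y.
Proof. by move=> lf; rewrite linear_formD // linear_formN. Qed.

Lemma linear_formC f a b x y : linear_form f ->
  f (a *: x + b *: y) = a * f x + b * f y.
Proof. by move=> lf; rewrite lf linear_formZ. Qed.

Definition supports f u :=
  [/\ linear_form f, f u = `|u| & forall x, f x <= `|x|].

Lemma supports_norm f u x : supports f u -> `|f x| <= `|x|.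
Proof.
move=> [lf _ fle]; rewrite ler_norml fle andbT lerNl -linear_formN //.
by rewrite -[`|x|]normrN.
Qed.

Definition independent e1 e2 := forall a b, a *: e1 + b *: e2 = 0 -> a = 0 /\ b = 0.

Definition spanning e1 e2 := forall x, exists a b, x = a *: e1 + b *: e2.

Lemma independent_sym e1 e2 : independent e1 e2 -> independent e2 e1.
Proof. by move=> ind a b; rewrite addrC => /ind[-> ->]. Qed.

Lemma independentP u e : u != 0 -> (forall a, e != a *: u) -> independent u e.
Proof.
move=> u0 ne a b abe; have b0 : b = 0.
  apply: contrapT => /eqP b0; have /eqP := ne (- (b^-1 * a)); apply.
  apply: (scalerI b0); rewrite scalerA mulrN mulrA divff // mul1r scaleNr.
  by apply/eqP; rewrite -addr_eq0 addrC abe.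
split=> //; move: abe; rewrite b0 scale0r addr0 => /eqP.
by rewrite scaler_eq0 (negbTE u0) orbF => /eqP.
Qed.

Lemma independent_neq0l e1 e2 : independent e1 e2 -> e1 != 0.
Proof.
move=> ind; apply/eqP => e0; have := ind 1 0.
by rewrite e0 scaler0 scale0r addr0 => /(_ erefl)[/eqP]; rewrite oner_eq0.
Qed.

Lemma independent_neq0r e1 e2 : independent e1 e2 -> e2 != 0.
Proof. by move=> /independent_sym/independent_neq0l. Qed.

Lemma coordinates e1 e2 : independent e1 e2 -> spanning e1 e2 ->
  exists A B : Z -> R, [/\ linear_form A, linear_form B &
    forall x, x = A x *: e1 + B x *: e2].
Proof.
move=> ind sp.
have /choice[c cP] : forall x, exists c : R * R, x = c.1 *: e1 + c.2 *: e2.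
  by move=> x; have [a [b ->]] := sp x; exists (a, b).
have clin a x y : (c (a *: x + y)).1 = a * (c x).1 + (c y).1 /\
    (c (a *: x + y)).2 = a * (c x).2 + (c y).2.
  have [|h1 h2] := ind ((c (a *: x + y)).1 - (a * (c x).1 + (c y).1))
    ((c (a *: x + y)).2 - (a * (c x).2 + (c y).2)); last by split; lra.
  rewrite !scalerBl addrACA -cP !scalerDl -!scalerA -opprD addrACA -scalerDr.
  by rewrite -!cP subrr.
exists (fun x => (c x).1), (fun x => (c x).2); split.
- by move=> a x y; have [] := clin a x y.
- by move=> a x y; have [] := clin a x y.
- exact: cP.
Qed.

(* Values at [a *: u + b *: e] with [a <= 0] are reduced to [a = 1] by adding a
   multiple of [u], along which the form and the norm agree. *)
Lemma supports_of_line f u e : linear_form f -> spanning u e -> f u = `|u| ->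
  (forall t, f (u + t *: e) <= `|u + t *: e|) -> supports f u.
Proof.
move=> lf sp fu fline; split=> // x; have [a [b ->]] := sp x.
have [a0|a0] := ltP 0 a.
  have -> : a *: u + b *: e = a *: (u + (b / a) *: e).
    by rewrite scalerDr scalerA mulrCA divff ?gt_eqF // mulr1.
  by rewrite linear_formZ // normrZ gtr0_norm // ler_pM2l.
have M0 : 0 <= 1 - a by lra.
have := fline b.
have -> : u + b *: e = (a *: u + b *: e) + (1 - a) *: u.
  by rewrite scalerBl scale1r addrAC [a *: u + _]addrC subrK.
rewrite linear_formD // linear_formZ // fu => h.
have := ler_normD (a *: u + b *: e) ((1 - a) *: u).
by rewrite normrZ (ger0_norm M0); lra.
Qed.

(** Hahn-Banach in the plane: the slope [c] along [e] is the infimum of the forward difference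
    quotients of the norm at [u], and convexity keeps every backward quotient below it. *)
Lemma supports_exists_of_basis u e : independent u e -> spanning u e ->
  exists f, supports f u.
Proof.
move=> ind sp; have [A [B [lA lB AB]]] := coordinates ind sp.
have coordu : A u = 1 /\ B u = 0.
  have [|h1 h2] := ind (A u - 1) (B u); last by split; lra.
  by rewrite scalerBl addrAC -AB scale1r subrr.
have coorde : A e = 0 /\ B e = 1.
  have [|h1 h2] := ind (A e) (B e - 1); last by split; lra.
  by rewrite scalerBl addrA -AB scale1r subrr.
pose S := [set (`|u + t *: e| - `|u|) / t | t in [set t : R | 0 < t]].
have convex s t : 0 < s -> 0 < t ->
    (`|u| - `|u - s *: e|) / s <= (`|u + t *: e| - `|u|) / t.
  move=> s0 t0; rewrite ler_pdivrMr // mulrAC ler_pdivlMr //.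
  have := ler_normD (t *: (u - s *: e)) (s *: (u + t *: e)).
  rewrite !normrZ !gtr0_norm //.
  have -> : t *: (u - s *: e) + s *: (u + t *: e) = (s + t) *: u.
    by rewrite !scalerDr !scalerN !scalerA addrACA mulrC addNr addr0 scalerDl addrC.
  by rewrite normrZ gtr0_norm ?addr_gt0 //; lra.
have S0 : S !=set0 by exists ((`|u + 1 *: e| - `|u|) / 1), 1 => //=.
have lbS s : 0 < s -> lbound S ((`|u| - `|u - s *: e|) / s).
  by move=> s0 _ [t t0 <-]; exact: convex.
have hlS : has_lbound S by exists ((`|u| - `|u - 1 *: e|) / 1); exact: lbS.
pose c := inf S; exists (fun x => `|u| * A x + c * B x).
have lf : linear_form (fun x => `|u| * A x + c * B x).
  by move=> a x y; rewrite lA lB; ring.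
apply: (@supports_of_line _ u e) => //; first by rewrite !coordu.1 !coordu.2; lra.
move=> t; rewrite (addrC u) lA lB coordu.1 coordu.2 coorde.1 coorde.2.
rewrite mulr0 add0r mulr1 mulr1 addr0 (addrC _ u).
have [t0|t0|->] := ltgtP t 0; last by rewrite scale0r addr0 mulr0 addr0.
- have nt0 : 0 < - t by lra.
  have : (`|u| - `|u - (- t) *: e|) / (- t) <= c.
    by apply: lb_le_inf => //; exact: lbS.
  by rewrite ler_pdivrMr // scaleNr opprK; lra.
- have : c <= (`|u + t *: e| - `|u|) / t by apply: ge_inf => //; exists t.
  by rewrite ler_pdivlMr //; lra.
Qed.

End LinearForms.

(** * Two-dimensional spaces *)

Section Planar.
Context {R : realType}.

(** Stated for every independent pair, so that a basis adapted to a given point is available at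
    once. *)
Definition planar (Z : normedModType R) := (exists e1 e2 : Z, independent e1 e2) /\
  forall e1 e2 : Z, independent e1 e2 -> spanning e1 e2.

(* Cramer's rule *)
Lemma spanning_planar (Z : normedModType R) (e1 e2 : Z) :
  independent e1 e2 -> spanning e1 e2 -> planar Z.
Proof.
move=> ind sp; split; first by exists e1, e2.
move=> v1 v2 indv x.
have [a1 [b1 E1]] := sp v1; have [a2 [b2 E2]] := sp v2; have [a [b E]] := sp x.
have comb c d : c *: v1 + d *: v2 = (c * a1 + d * a2) *: e1 + (c * b1 + d * b2) *: e2.
  by rewrite E1 E2 !scalerDr !scalerA addrACA -!scalerDl.
have D0 : a1 * b2 - a2 * b1 != 0.
  apply/eqP => D0.
  have [|h1 h2] := indv b2 (- b1).
    rewrite comb; have -> : b2 * a1 + - b1 * a2 = 0 by lra.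
    have -> : b2 * b1 + - b1 * b2 = 0 by lra.
    by rewrite !scale0r addr0.
  have [|h3 h4] := indv a2 (- a1).
    rewrite comb; have -> : a2 * a1 + - a1 * a2 = 0 by lra.
    have -> : a2 * b1 + - a1 * b2 = 0 by lra.
    by rewrite !scale0r addr0.
  have := independent_neq0l indv; rewrite E1.
  have -> : a1 = 0 by lra.
  have -> : b1 = 0 by lra.
  by rewrite !scale0r addr0 eqxx.
exists ((a * b2 - a2 * b) / (a1 * b2 - a2 * b1)),
  ((a1 * b - a * b1) / (a1 * b2 - a2 * b1)); rewrite comb E.
by congr (_ *: _ + _ *: _); field.
Qed.

Lemma planar_independent (Z : normedModType R) (u : Z) :
  planar Z -> u != 0 -> exists e, independent u e.
Proof.
move=> [[e1 [e2 ind]] _] u0.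
apply: contrapT => no.
have par e : exists a, e = a *: u.
  apply: contrapT => ne; apply: no; exists e; apply: independentP => // a.
  by apply/eqP => ea; apply: ne; exists a.
have [a1 E1] := par e1; have [a2 E2] := par e2.
have [|h1 /eqP] := ind a2 (- a1); first by rewrite E1 E2 !scalerA mulNr scaleNr mulrC subrr.
rewrite oppr_eq0 => /eqP h2; have := independent_neq0l ind.
by rewrite E1 h2 scale0r eqxx.
Qed.

Lemma supports_exists (Z : normedModType R) :
  planar Z -> exists phi : Z -> Z -> R, forall u, supports (phi u) u.
Proof.
move=> pZ; suff /choice[phi phiP] : forall u : Z, exists f, supports f u by exists phi.
move=> u; have [->|u0] := eqVneq u 0.
  (* The origin gets the zero form, which makes [phi] total. *)
  exists (fun=> 0); split; rewrite ?normr0 //.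
  by move=> a x y; rewrite mulr0 addr0.
have [e ind] := planar_independent pZ u0.
by apply: (supports_exists_of_basis ind); exact: pZ.2.
Qed.

End Planar.

(** * Quadratic points and continuity of the support map *)

Section Support.
Context {R : realType} {Z : normedModType R} (phi : Z -> Z -> R).
Hypothesis phiP : forall u, supports (phi u) u.
Implicit Types u v w x y e p s : Z.

Definition unique_supports := forall u (f g : Z -> R), u != 0 ->
  supports f u -> supports g u -> f =1 g.

(** Differentiability of the norm at [u] in a weak form: by convexity the difference quotient
    increases with [t], so a single [t] for each [eps] is enough, and [- e] gives the other side. *)
Definition gateaux := forall u e (eps : R), u != 0 -> phi u e = 0 -> 0 < eps ->
  exists2 t : R, 0 < t & `|u + t *: e| <= `|u| + eps * t.

Definition midpoint_convex := forall a b : Z, `|a| = 1 -> `|b| = 1 ->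
  `|a + b| = 2 -> a = b.

Definition quadratic_at v := exists C eta : R, [/\ 0 <= C, 0 < eta &
  forall h, `|h| < eta -> `|v + h| <= `|v| + phi v h + C * `|h| ^+ 2].

Let phiL u : linear_form (phi u). Proof. by have [] := phiP u. Qed.
Let phiE u : phi u u = `|u|. Proof. by have [] := phiP u. Qed.
Let phi_le u x : phi u x <= `|x|. Proof. by have [] := phiP u. Qed.
Let phiD u x y : phi u (x + y) = phi u x + phi u y. Proof. exact: linear_formD. Qed.
Let phiB u x y : phi u (x - y) = phi u x - phi u y. Proof. exact: linear_formB. Qed.
Let phiN u x : phi u (- x) = - phi u x. Proof. exact: linear_formN. Qed.
Let phiZ u a x : phi u (a *: x) = a * phi u x. Proof. exact: linear_formZ. Qed.
Let phi0 u : phi u 0 = 0. Proof. exact: linear_form0. Qed.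

(** At a corner the form with value [|u|] at [u] and [eps] at [e] is a second support functional:
    [above] gives the bound for [t > 0], and [phi u] gives it for [t <= 0]. *)
Lemma corner_support u e (eps : R) : planar Z -> u != 0 -> phi u e = 0 -> 0 < eps ->
  (forall t, 0 < t -> `|u| + eps * t < `|u + t *: e|) ->
  independent u e /\ exists2 g, supports g u & g e = eps.
Proof.
move=> pZ u0 ue0 eps0 above.
have e0 : e != 0.
  by apply/eqP => e0; have := above 1 ltr01; rewrite e0 scaler0 addr0; lra.
have ind : independent u e.
  apply: independentP => // a; apply/eqP => ea.
  move: ue0; rewrite ea phiZ phiE => /eqP.
  by rewrite mulf_eq0 normr_eq0 (negbTE u0) orbF => /eqP a0; move: e0; rewrite ea a0 scale0r eqxx.
split=> //; have sp := pZ.2 _ _ ind.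
have [A [B [lA lB AB]]] := coordinates ind sp.
have [|/eqP + Bu] := ind (A u - 1) (B u).
  by rewrite scalerBl addrAC -AB scale1r subrr.
rewrite subr_eq0 => /eqP Au.
have [|Ae /eqP] := ind (A e) (B e - 1).
  by rewrite scalerBl addrA -AB scale1r subrr.
rewrite subr_eq0 => /eqP Be.
pose g x := `|u| * A x + eps * B x.
have lg : linear_form g by move=> a x y; rewrite /g lA lB; ring.
have gu : g u = `|u| by rewrite /g Bu Au mulr1 mulr0 addr0.
have ge : g e = eps by rewrite /g Ae Be mulr1 mulr0 add0r.
exists g => //; apply: (supports_of_line lg sp gu) => t.
rewrite linear_formD // linear_formZ // gu ge.
have [t0|t0] := ltP 0 t; first by have := above t t0; lra.
have := phi_le u (u + t *: e).
rewrite phiD phiZ ue0 phiE mulr0 addr0.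
have : 0 <= eps * - t by rewrite mulr_ge0 ?oppr_ge0 // ltW.
by lra.
Qed.

Lemma gateaux_of_unique : planar Z -> unique_supports -> gateaux.
Proof.
move=> pZ uniq u e eps u0 ue0 eps0; apply: contrapT => no.
have [|_ [g sg ge]] := corner_support pZ u0 ue0 eps0.
  by move=> t t0; rewrite ltNge; apply/negP => le; apply: no; exists t.
by have := uniq u g (phi u) u0 sg (phiP u) e; rewrite ge ue0; lra.
Qed.

Lemma support_near w u : `|phi w u - `|u| | <= 2 * `|w - u|.
Proof.
have E : phi w u = `|w| - phi w (w - u) by rewrite phiB phiE; lra.
have h1 := supports_norm (w - u) (phiP w).
have h2 := lerB_dist w u; have h3 := lerB_dist u w.
move: h1; rewrite ler_norml => /andP[h4 h5].
by rewrite E ler_norml; move: h3; rewrite (distrC u); lra.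
Qed.

(** Test [phi w] on [u + t e'] with [e'] in the kernel of [phi u] and the [t] given by [gateaux]:
    this bounds [t * phi w e'] by [t d / 2 + 2 |w - u|]. The component of [e] along [u] is
    controlled by [support_near]. *)
Lemma continuous_support : gateaux -> forall u e (eps : R), u != 0 -> 0 < eps ->
  exists2 delta : R, 0 < delta &
    forall w, `|w - u| < delta -> `|phi w e - phi u e| < eps.
Proof.
move=> gat u e eps u0 eps0.
have across e' d : phi u e' = 0 -> 0 < d ->
    exists2 delta : R, 0 < delta & forall w, `|w - u| < delta -> phi w e' < d.
  move=> ue' d0; have [t t0 ht] := gat u e' (d / 2) u0 ue' ltac:(lra).
  exists (t * d / 4) => [|w wu]; first by rewrite divr_gt0 // mulr_gt0.
  have := phi_le w (u + t *: e'); rewrite phiD phiZ.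
  have := support_near w u; rewrite ler_norml => /andP[h1 _] h2.
  have : t * phi w e' < t * d by lra.
  by rewrite ltr_pM2l.
have nu : 0 < `|u| by rewrite normr_gt0.
pose c := phi u e / `|u|; pose e' := e - c *: u.
have ue' : phi u e' = 0.
  by rewrite phiB phiZ phiE divfK ?subrr // gt_eqF.
have [d1 d10 h1] := across e' (eps / 2) ue' ltac:(lra).
have [|d2 d20 h2] := across (- e') (eps / 2) _ ltac:(lra).
  by rewrite phiN ue' oppr0.
have C0 : 0 < 4 * (`|c| + 1) by rewrite mulr_gt0 // ltr_wpDl.
exists (Num.min (Num.min d1 d2) (eps / (4 * (`|c| + 1)))) => [|w].
  by rewrite !lt_min d10 d20 divr_gt0.
rewrite !lt_min => /andP[/andP[w1 w2]]; rewrite ltr_pdivlMr // => w3.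
have {}h1 := h1 w w1; have := h2 w w2; rewrite phiN => {}h2.
have E : phi w e - phi u e = phi w e' + c * (phi w u - `|u|).
  have -> : phi u e = c * `|u| by rewrite divfK // gt_eqF.
  rewrite /e' phiB phiZ; ring.
have h3 : `|c * (phi w u - `|u|)| < eps / 2.
  rewrite normrM; apply: (@le_lt_trans _ _ (`|c| * (2 * `|w - u|))).
    by rewrite ler_wpM2l // support_near.
  apply: (@le_lt_trans _ _ ((`|c| + 1) * (2 * `|w - u|))); last by lra.
  by rewrite ler_wpM2r ?mulr_ge0 // lerDl.
by rewrite E; move: h3; rewrite !ltr_norml => /andP[h3 h4]; apply/andP; split; lra.
Qed.

(** Projecting along [e1] by means of [phi e1] at most doubles the norm, and sends [a e1 + b e2] to
    [b] times a fixed nonzero vector. *)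
Lemma coordinate_bound e1 e2 : independent e1 e2 ->
  exists2 c : R, 0 < c & forall a b, `|b| <= c * `|a *: e1 + b *: e2|.
Proof.
move=> ind; have n1 : 0 < `|e1| by rewrite normr_gt0 (independent_neq0l ind).
pose f := phi e1; pose e := e2 - (f e2 / `|e1|) *: e1.
have e0 : 0 < `|e|.
  rewrite normr_gt0; apply/eqP => e0.
  have [|_ /eqP] := ind (- (f e2 / `|e1|)) 1; last by rewrite oner_eq0.
  by rewrite scale1r scaleNr addrC.
exists (2 / `|e|); first by rewrite divr_gt0.
move=> a b; set x := a *: e1 + b *: e2.
have bE : b *: e = x - (f x / `|e1|) *: e1.
  rewrite /e scalerBr scalerA /x /f phiD !phiZ phiE.
  by rewrite mulrDl mulfK ?gt_eqF // scalerDl opprD addrACA subrr add0r mulrA.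
have : `|b *: e| <= `|x| + `|x|.
  rewrite bE; apply: (le_trans (ler_normB _ _)); rewrite lerD2l normrZ normrM.
  rewrite [`| `|e1|^-1 |]gtr0_norm ?invr_gt0 // divfK ?gt_eqF //.
  exact: (supports_norm x (phiP e1)).
by rewrite normrZ mulrAC ler_pdivlMr //; lra.
Qed.

Lemma coordinates_bound e1 e2 : independent e1 e2 ->
  exists2 c : R, 0 < c & forall a b,
    `|a| <= c * `|a *: e1 + b *: e2| /\ `|b| <= c * `|a *: e1 + b *: e2|.
Proof.
move=> ind; have [c1 c10 h1] := coordinate_bound ind.
have [c2 c20 h2] := coordinate_bound (independent_sym ind).
exists (c1 + c2) => [|a b]; first exact: addr_gt0.
have n0 := normr_ge0 (a *: e1 + b *: e2).
split; [have := h2 b a; rewrite addrC => h|have h := h1 a b]; apply: (le_trans h);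
  by rewrite ler_wpM2r // ?lerDl ?lerDr ltW.
Qed.

Lemma quadratic_slope (d C eta : R) : 0 < C -> 0 < eta ->
  (forall k, `|k| < eta -> k * d <= C * k ^+ 2) -> d = 0.
Proof.
move=> C0 eta0 hk; apply/eqP; rewrite -normr_eq0 eq_le normr_ge0 andbT leNgt.
apply/negP => nd.
(* Testing at [k = sg d * m] yields [|d| <= C m], while [C m <= |d| / 2] by the choice of [m]. *)
pose m := Num.min (eta / 2) (`|d| / (2 * C)).
have m0 : 0 < m by rewrite lt_min !divr_gt0 // mulr_gt0.
have m1 : m < eta by apply: (@le_lt_trans _ _ (eta / 2)); [rewrite ge_min lexx|lra].
have m2 : m * (2 * C) <= `|d| by rewrite -ler_pdivlMr ?mulr_gt0 // ge_min lexx orbT.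
have := hk (Num.sg d * m).
rewrite normrM (gtr0_norm m0) normr_sg -normr_eq0 (gt_eqF nd) mul1r => /(_ m1).
rewrite mulrAC -normrEsg exprMn sqr_sg -normr_eq0 (gt_eqF nd) mul1r.
rewrite expr2 mulrA ler_pM2r //.
by lra.
Qed.

(** Homogeneity absorbs the radial part of [h = a v + b e]: [v + h] is [1 + a] times a point of the
    line [v + k e]. *)
Lemma quadratic_of_line v e : independent v e -> spanning v e ->
  forall C eta : R, 0 < C -> 0 < eta ->
  (forall k, `|k| < eta -> `|v + k *: e| <= `|v| + k * phi v e + C * k ^+ 2) ->
  quadratic_at v.
Proof.
move=> ind sp C eta C0 eta0 hk.
have [c c0 hc] := coordinates_bound ind.
(* The first radius gives [1 + a >= 1/2], which explains the factor 2 in the constant; the second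
   then gives [|b / (1 + a)| < eta]. *)
exists (2 * C * c ^+ 2), (Num.min (1 / (2 * c)) (eta / (2 * c))); split.
- by rewrite !mulr_ge0 ?exprn_ge0 ?ltW.
- by rewrite lt_min !divr_gt0 // mulr_gt0.
move=> h; rewrite lt_min !ltr_pdivlMr ?mulr_gt0 // => /andP[h1 h2].
have [a [b E]] := sp h; have [ha hb] := hc a b; rewrite -E in ha hb.
have a2 : - (1 / 2) <= a.
  have : `|a| <= 1 / 2 by lra.
  by rewrite ler_norml => /andP[].
have a1 : 0 < 1 + a by lra.
have bk : `|b / (1 + a)| < eta.
  by rewrite normrM normfV (gtr0_norm a1) ltr_pdivrMr //; nra.
have {}hk := hk _ bk.
have -> : v + h = (1 + a) *: (v + (b / (1 + a)) *: e).
  by rewrite scalerDr scalerA mulrCA divff ?gt_eqF // mulr1 E scalerDl scale1r addrA.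
rewrite normrZ (gtr0_norm a1).
apply: (@le_trans _ _ ((1 + a) * (`|v| + b / (1 + a) * phi v e + C * (b / (1 + a)) ^+ 2))).
  by rewrite ler_pM2l.
have -> : (1 + a) * (`|v| + b / (1 + a) * phi v e + C * (b / (1 + a)) ^+ 2) =
    (1 + a) * `|v| + b * phi v e + C * (b ^+ 2 / (1 + a)) by field; rewrite gt_eqF.
have -> : phi v h = a * `|v| + b * phi v e by rewrite E phiD !phiZ phiE.
have b2 : b ^+ 2 <= c ^+ 2 * `|h| ^+ 2.
  rewrite -exprMn -(real_normK (num_real b)) ler_sqr ?nnegrE //.
  by apply: (le_trans _ hb).
have : b ^+ 2 / (1 + a) <= 2 * (c ^+ 2 * `|h| ^+ 2).
  rewrite ler_pdivrMr //; apply: (le_trans b2).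
  have X0 : 0 <= c ^+ 2 * `|h| ^+ 2 by rewrite mulr_ge0 ?exprn_ge0 // ltW.
  by nra.
by rewrite -(ler_pM2l C0); lra.
Qed.

(* A parabola of large curvature lowered onto the graph of the norm along a line
   touches it at a point close to the vertex, and the norm is quadratic there. *)
Lemma quadratic_dense : planar Z -> forall v (delta : R), v != 0 -> 0 < delta ->
  exists w, [/\ w != 0, `|w - v| < delta & quadratic_at w].
Proof.
move=> pZ v delta v0 d0.
have [e ind] := planar_independent pZ v0.
have ne : 0 < `|e| by rewrite normr_gt0 (independent_neq0r ind).
pose d := delta / `|e|; have dd : 0 < d by rewrite divr_gt0.
(* At the ends [|m| = d] the parabola takes away [C d^2 = 2 d |e|] while the norm gains at most
   [d |e|], so the maximum of [g] is interior. *)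
pose C := 2 * `|e| / d; have C0 : 0 < C by rewrite divr_gt0 // mulr_gt0.
pose g (m : R) := `|v + m *: e| - C * m ^+ 2.
have cg : {within `[- d, d], continuous g}.
  apply: continuous_subspaceT => m; apply: cvgB.
    by apply: cvg_norm; apply: cvgD; [exact: cvg_cst|apply: cvgZr_tmp; exact: cvg_id].
  by apply: cvgMr; apply: exprn_continuous.
have [m0 m0d mmax] := EVT_max (ltac:(lra) : - d <= d) cg.
have g0 : `|v| <= g m0.
  have := mmax 0; rewrite /g scale0r addr0 expr0n /= mulr0 subr0; apply.
  by rewrite in_itv /=; lra.
have Cd : C * d = 2 * `|e| by rewrite divfK // gt_eqF.
have m0lt : `|m0| < d.
  rewrite lt_neqAle; apply/andP; split; last by rewrite ler_norml; move: m0d; rewrite in_itv.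
  apply/eqP => m0E; move: g0; rewrite /g -(real_normK (num_real m0)) m0E expr2 mulrA Cd.
  have := ler_normD v (m0 *: e); rewrite normrZ m0E.
  have : 0 < d * `|e| by rewrite mulr_gt0.
  lra.
pose w := v + m0 *: e.
have indw : independent w e.
  move=> a b; rewrite /w scalerDr -addrA scalerA -scalerDl => /ind[-> ].
  by rewrite mul0r add0r.
have w0 := independent_neq0l indw.
pose eta := d - `|m0|; have eta0 : 0 < eta by rewrite /eta; lra.
have hk k : `|k| < eta -> `|w + k *: e| <= `|w| + 2 * C * m0 * k + C * k ^+ 2.
  move=> kd; have := mmax (m0 + k).
  have : `|m0 + k| <= d by apply: (le_trans (ler_normD _ _)); rewrite /eta in kd; lra.
  rewrite ler_norml in_itv /= => -> /(_ isT).
  by rewrite /g scalerDl addrA -/w; lra.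
(* The norm lies above its support line and below the parabola, and all three meet at [w], so the
   two slopes agree. *)
have slope : phi w e - 2 * C * m0 = 0.
  apply: (@quadratic_slope _ C eta) => // k kd.
  have := hk k kd; have := phi_le w (w + k *: e).
  by rewrite phiD phiZ phiE; lra.
exists w; split=> //.
  rewrite /w addrAC subrr add0r normrZ -ltr_pdivlMr //.
apply: (@quadratic_of_line w e indw (pZ.2 _ _ indw) C eta) => // k kd.
have -> : phi w e = 2 * C * m0 by lra.
by have := hk k kd; lra.
Qed.

(** Take a step [k] along [e] as long as [h = w - v]. The norm of [w + k] is bounded above by the
    expansion at [v] and below by [phi w]; the errors are of order [|h|^2 = |h| |k|], and dividing
    by [|k|] leaves a Lipschitz bound. *)
Lemma calm_of_quadratic v : quadratic_at v -> exists C delta : R, [/\ 0 <= C, 0 < delta &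
  forall w e, `|w - v| < delta -> `|phi w e - phi v e| <= C * `|w - v| * `|e|].
Proof.
move=> [C [eta [C0 eta0 hq]]]; exists (4 * C), (eta / 2); split; try lra.
suff H w e : `|w - v| < eta / 2 -> phi w e - phi v e <= 4 * C * `|w - v| * `|e|.
  move=> w e wv; rewrite ler_norml H // andbT.
  by have := H w (- e) wv; rewrite !phiN normrN; lra.
move=> wv; have [->|e0] := eqVneq e 0.
  by rewrite !phi0 normr0 mulr0 subrr.
have [->|wv0] := eqVneq w v; first by rewrite !subrr normr0 mulr0 mul0r.
pose h := w - v; have nh : 0 < `|h| by rewrite normr_gt0 subr_eq0.
have ne : 0 < `|e| by rewrite normr_gt0.
pose k := (`|h| / `|e|) *: e.
have nk : `|k| = `|h|.
  by rewrite normrZ normrM normfV !normr_id divfK // gt_eqF.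
have nhk : `|h + k| <= 2 * `|h| by have := ler_normD h k; rewrite nk; lra.
have wE : w = v + h by rewrite /h addrC subrK.
have h1 := hq (h + k) (ltac:(rewrite -/h in wv; lra)).
have h2 := phi_le w (w + k); have h3 := phi_le v w.
have sq : `|h + k| ^+ 2 <= 4 * `|h| ^+ 2.
  have -> : 4 * `|h| ^+ 2 = (2 * `|h|) ^+ 2 by ring.
  by rewrite ler_sqr ?nnegrE //; lra.
have := ler_wpM2l C0 sq.
move: h1 h2 h3; rewrite addrA -wE !phiD phiE => h1 h2 h3 h4.
have h5 : phi v w = `|v| + phi v h by rewrite {1}wE phiD phiE.
have h6 : phi v (- v) = - `|v| by rewrite phiN phiE.
have : phi w k - phi v k <= 4 * C * `|h| ^+ 2 by lra.
rewrite !phiZ -mulrBr mulrAC ler_pdivrMr // expr2 => h7; rewrite -/h -(ler_pM2l nh); lra.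
Qed.

Lemma sphere_of_not_quadratic p : `|p| = 1 -> ~ quadratic_at p ->
  forall K : R, exists x, `|x| = 1 /\ K * `|x - p| ^+ 2 < 1 - phi p x.
Proof.
move=> p1 nq K0; pose K := Num.max K0 1.
suff [x [x1 hx]] : exists x, `|x| = 1 /\ K * `|x - p| ^+ 2 < 1 - phi p x.
  exists x; split => //; apply: le_lt_trans hx.
  by rewrite ler_wpM2r ?exprn_ge0 // le_max lexx.
have K1 : 1 <= K by rewrite le_max lexx orbT.
(* The expansion is made to fail with a larger constant because [p + h] must still be projected to
   the sphere: once the goal is multiplied by [n >= 1/2], its left-hand side is at most
   [8 K |h|^2]. *)
have [h [hh hl]] : exists h, `|h| < 1 / 2 /\ `|p| + phi p h + 24 * K * `|h| ^+ 2 < `|p + h|.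
  apply: contrapT => no; apply: nq; exists (24 * K), (1 / 2); split; try lra.
  by move=> h hh; rewrite leNgt; apply/negP => hl; apply: no; exists h.
rewrite p1 in hl; pose n := `|p + h|.
have n_ge : 1 / 2 <= n by have := lerB_normD p h; rewrite p1 -/n; lra.
have n_le : n <= 3 / 2 by have := ler_normD p h; rewrite p1 -/n; lra.
have n1 : `|1 - n| <= `|h|.
  have := lerB_normD p h; have := ler_normD p h; rewrite p1 -/n ler_norml; lra.
have n0 : 0 < n by lra.
exists (n^-1 *: (p + h)); split.
  by rewrite normrZ -/n gtr0_norm ?invr_gt0 // mulVf // gt_eqF.
have -> : n^-1 *: (p + h) - p = n^-1 *: ((1 - n) *: p + h).
  rewrite [in RHS]scalerDr scalerA mulrBr mulr1 mulVf ?gt_eqF // scalerBl scale1r.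
  by rewrite scalerDr addrAC.
rewrite phiZ phiD phiE p1 normrZ exprMn.
rewrite gtr0_norm ?invr_gt0 //.
have b1 : `|(1 - n) *: p + h| ^+ 2 <= 4 * `|h| ^+ 2.
  have -> : 4 * `|h| ^+ 2 = (2 * `|h|) ^+ 2 by ring.
  rewrite ler_sqr ?nnegrE ?mulr_ge0 //.
  by apply: (le_trans (ler_normD _ _)); rewrite normrZ p1; lra.
have b2 : K * (n^-1 ^+ 2 * `|(1 - n) *: p + h| ^+ 2) <= K * (n^-1 ^+ 2 * (4 * `|h| ^+ 2)).
  have n20 : 0 <= n^-1 ^+ 2 by rewrite exprn_ge0 // invr_ge0 ltW.
  by rewrite ler_wpM2l ?ler_wpM2l //; lra.
apply: (le_lt_trans b2).
have -> : 1 - n^-1 * (1 + phi p h) = (n - (1 + phi p h)) / n.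
  by field; rewrite gt_eqF.
rewrite ltr_pdivlMr //.
have -> : K * (n^-1 ^+ 2 * (4 * `|h| ^+ 2)) * n = 4 * K * `|h| ^+ 2 * n^-1.
  by field; rewrite gt_eqF.
rewrite -/n in hl; apply: le_lt_trans (ltac:(lra) : 24 * K * `|h| ^+ 2 < n - (1 + phi p h)).
have X0 : 0 <= K * `|h| ^+ 2 by rewrite mulr_ge0 ?exprn_ge0 //; lra.
have : n^-1 <= 2 by rewrite invf_ple ?posrE //; lra.
by nra.
Qed.

End Support.
Arguments midpoint_convex {R} Z.
Arguments unique_supports {R} Z.

(** * Chords of the unit sphere *)

Section Chords.
Context {R : realType} {Z : normedModType R} (phi : Z -> Z -> R).
Hypothesis phiP : forall u, supports (phi u) u.
Implicit Types a b u v w x y e p s : Z.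

Let phiL u : linear_form (phi u). Proof. by have [] := phiP u. Qed.
Let phiE u : phi u u = `|u|. Proof. by have [] := phiP u. Qed.
Let phi_le u x : phi u x <= `|x|. Proof. by have [] := phiP u. Qed.
Let phiD u x y : phi u (x + y) = phi u x + phi u y. Proof. exact: linear_formD. Qed.
Let phiB u x y : phi u (x - y) = phi u x - phi u y. Proof. exact: linear_formB. Qed.
Let phiN u x : phi u (- x) = - phi u x. Proof. exact: linear_formN. Qed.
Let phiZ u (a : R) x : phi u (a *: x) = a * phi u x. Proof. exact: linear_formZ. Qed.

Lemma continuous_norm_line u e : continuous (fun t : R => `|u + t *: e|).
Proof.
move=> m; apply: cvg_norm; apply: cvgD; first exact: cvg_cst.
by apply: cvgZr_tmp; exact: cvg_id.
Qed.

(** [f] takes the value 2 on the sum of the two normalized vectors, so that sum has norm 2. *)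
Lemma eq_of_supports (f : Z -> R) a b : midpoint_convex Z -> supports f a ->
  f b = `|b| -> `|a| = `|b| -> a = b.
Proof.
move=> mc [fL fa fle] fb ab; have [a0|a0] := eqVneq a 0.
  by move: ab; rewrite a0 normr0 => /esym/normr0_eq0 ->.
have na : 0 < `|a| by rewrite normr_gt0.
have nai : `|(`|a|^-1 : R)| = `|a|^-1 by rewrite gtr0_norm ?invr_gt0.
apply: (@scalerI _ _ `|a|^-1); first by rewrite gt_eqF // invr_gt0.
have unit : `|a|^-1 * `|a| = 1 by rewrite mulVf // gt_eqF.
apply: mc; rewrite ?normrZ ?nai -?ab //.
apply/eqP; rewrite eq_le; apply/andP; split.
  by rewrite (le_trans (ler_normD _ _)) // !normrZ nai -ab unit; lra.
have := fle (`|a|^-1 *: a + `|a|^-1 *: b).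
by rewrite linear_formC // fa fb -ab unit; lra.
Qed.

Lemma norm_between_lt1 a b (t : R) : midpoint_convex Z -> `|a| <= 1 -> `|b| <= 1 ->
  a != b -> 0 < t < 1 -> `|t *: a + (1 - t) *: b| < 1.
Proof.
move=> mc a1 b1 ab /andP[t0 t1]; rewrite ltNge; apply/negP.
set m := _ + _ => m1; have mE : phi m m = t * phi m a + (1 - t) * phi m b.
  by rewrite {2}/m phiD !phiZ.
have ha := phi_le m a; have hb := phi_le m b; rewrite phiE in mE.
have fa : phi m a = 1 by nra.
have fb : phi m b = 1 by nra.
move/eqP: ab; apply; apply: mc; try lra.
apply/eqP; rewrite eq_le; apply/andP; split.
  by rewrite (le_trans (ler_normD _ _)) //; lra.
by have := phi_le m (a + b); rewrite phiD fa fb; lra.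
Qed.

(** Otherwise [b] would lie strictly between two points of the ball and have norm below 1. *)
Lemma norm_beyond_gt1 a b (t : R) : midpoint_convex Z -> `|a| = 1 -> `|b| = 1 ->
  a != b -> 1 < t -> 1 < `|a + t *: (b - a)|.
Proof.
move=> mc a1 b1 ab t1; rewrite ltNge; apply/negP => le.
have t0 : t != 0 by rewrite gt_eqF //; lra.
have t01 : 0 < t^-1 < 1 by rewrite invr_gt0 invf_lt1; lra.
have := @norm_between_lt1 (a + t *: (b - a)) a t^-1 mc le (ltac:(lra)).
have -> : t^-1 *: (a + t *: (b - a)) + (1 - t^-1) *: a = b.
  by rewrite scalerDr scalerA mulVf // scale1r scalerBl scale1r addrC addrA subrK addrC subrK.
rewrite b1 ltxx => h.
suff ne : a + t *: (b - a) != a by have := h ne t01.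
by rewrite -subr_eq0 addrAC subrr add0r scaler_eq0 negb_or t0 subr_eq0 eq_sym.
Qed.

Lemma sphere_chord_ivt p v (t0 t1 : R) : t0 <= t1 ->
  `|p - t0 *: v| <= 1 -> 1 <= `|p - t1 *: v| ->
  exists t : R, t0 <= t <= t1 /\ `|p - t *: v| = 1.
Proof.
move=> t01 h0 h1.
have [||t tin ht] := @IVT R (fun t => `|p + t *: (- v)|) t0 t1 1 t01.
- exact/continuous_subspaceT/continuous_norm_line.
- by rewrite !scalerN ge_min le_max h0 h1 orbT.
by exists t; rewrite -scalerN; split => //; move: tin; rewrite in_itv.
Qed.

(** Smoothness at [p] makes the ray [p - t v] enter the ball at once; far away it is outside, so it
    crosses the sphere again. Every direction of the open half-space [phi p > 0] is thus a chord
    from [p]. *)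
Lemma sphere_chord p v : gateaux phi -> `|p| = 1 -> 0 < phi p v ->
  exists2 t : R, 0 < t & `|p - t *: v| = 1.
Proof.
move=> gat p1 pv; pose a : R := phi p v; pose e := v - a *: p.
have p0 : p != 0 by rewrite -normr_gt0 p1.
have v0 : 0 < `|v| by apply: (lt_le_trans pv).
have pe : phi p (- e) = 0 by rewrite phiN phiB phiZ phiE p1 mulr1 subrr oppr0.
have [t0 t00 ht0] := gat p (- e) (a / 2) p0 pe (ltac:(rewrite /a; lra)).
have m0 : 0 < 1 + a * t0 by rewrite addr_gt0 // mulr_gt0.
(* With this [t], [p - t v] is [p - t0 e] divided by [1 + a t0], where [gateaux] bounds the norm of
   [p - t0 e] by [1 + (a / 2) t0]. *)
pose t := t0 / (1 + a * t0); have tt0 : 0 < t by rewrite divr_gt0.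
have small : `|p - t *: v| <= 1.
  have -> : p - t *: v = (1 + a * t0)^-1 *: (p + t0 *: (- e)).
    have -> : p + t0 *: (- e) = (1 + a * t0) *: p - t0 *: v.
      rewrite scalerN scalerBr opprB scalerA scalerDl scale1r (mulrC t0).
      by rewrite addrA.
    by rewrite scalerBr !scalerA mulVf ?gt_eqF // scale1r /t mulrC.
  rewrite normrZ gtr0_norm ?invr_gt0 // mulrC ler_pdivrMr // mul1r.
  rewrite p1 in ht0; apply: (le_trans ht0).
  by have : 0 < a * t0; [rewrite mulr_gt0|lra].
pose t1 := t + 2 / `|v|.
have t1t : t <= t1 by rewrite lerDl divr_ge0.
have big : 1 <= `|p - t1 *: v|.
  have := lerB_dist (t1 *: v) p; rewrite (distrC (t1 *: v)) normrZ p1.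
  have t10 : 0 < t1 by exact: lt_le_trans t1t.
  rewrite gtr0_norm // mulrDl divfK ?gt_eqF //.
  by have : 0 < t * `|v|; [rewrite mulr_gt0|lra].
have [t2 [/andP[tt2 _] ht2]] := sphere_chord_ivt t1t small big.
by exists t2 => //; exact: lt_le_trans tt2.
Qed.

(** By strict convexity the line through [p] and [s] is inside the ball just before [s] and outside
    just after it, with a margin [m]; lines from [p] in nearby directions therefore still cross the
    sphere near [s]. This turns density of directions into density of endpoints. *)
Lemma sphere_chord_near p s (delta : R) : midpoint_convex Z -> `|p| = 1 -> `|s| = 1 ->
  s != p -> 0 < delta -> exists2 eta : R, 0 < eta & forall v, `|v - (p - s)| < eta ->
    exists s' (t : R), [/\ `|s'| = 1, `|s' - s| < delta, 0 < t & p - s' = t *: v].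
Proof.
move=> mc p1 s1 sp d0; pose v0 := p - s.
have nv : `|v0| <= 2 by rewrite (le_trans (ler_normB _ _)) // p1 s1; lra.
pose t := Num.min (1 / 2) (delta / 8).
have t0 : 0 < t by rewrite lt_min; lra.
have t12 : t <= 1 / 2 by rewrite ge_min lexx.
have td : t <= delta / 8 by rewrite ge_min lexx orbT.
have lo : `|p - (1 - t) *: v0| < 1.
  have -> : p - (1 - t) *: v0 = t *: p + (1 - t) *: s.
    rewrite scalerBr opprB addrCA addrC; congr (_ + _).
    by rewrite -{1}(scale1r p) -scalerBl; congr (_ *: _); lra.
  by apply: norm_between_lt1 => //; rewrite ?p1 ?s1 // 1?eq_sym //; lra.
have hi : 1 < `|p - (1 + t) *: v0|.
  have -> : p - (1 + t) *: v0 = p + (1 + t) *: (s - p) by rewrite -scalerN opprB.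
  by apply: norm_beyond_gt1 => //; rewrite 1?eq_sym //; lra.
pose m := Num.min (1 - `|p - (1 - t) *: v0|) (`|p - (1 + t) *: v0| - 1).
have m0 : 0 < m by rewrite lt_min; lra.
have m1 : m <= 1 - `|p - (1 - t) *: v0| by rewrite ge_min lexx.
have m2 : m <= `|p - (1 + t) *: v0| - 1 by rewrite ge_min lexx orbT.
exists (Num.min (m / 4) (delta / 8)) => [|v]; first by rewrite lt_min; lra.
rewrite -/v0 lt_min => /andP[vm vd].
have near (r : R) : 0 <= r <= 2 -> `| `|p - r *: v| - `|p - r *: v0| | <= m / 2.
  move=> r02; apply: (le_trans (ler_dist_dist _ _)).
  have -> : p - r *: v - (p - r *: v0) = r *: (v0 - v).
    by rewrite opprB addrC addrA subrK -scalerBr.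
  by rewrite normrZ ger0_norm ?(distrC v0); [have := normr_ge0 (v - v0); nra|lra].
have n1 := near (1 - t) ltac:(lra); have n2 := near (1 + t) ltac:(lra).
move: n1 n2; rewrite !ler_norml => /andP[_ n1] /andP[n2 _].
have [r [/andP[r1 r2] hr]] := @sphere_chord_ivt p v (1 - t) (1 + t)
  ltac:(lra) ltac:(lra) ltac:(lra).
exists (p - r *: v), r; split=> //; [|lra|by rewrite opprB addrC subrK].
have -> : p - r *: v - s = r *: (v0 - v) + (1 - r) *: v0.
  apply/esym; rewrite scalerBl scale1r scalerBr addrC addrA subrK.
  by rewrite /v0 addrAC.
apply: (le_lt_trans (ler_normD _ _)); rewrite !normrZ (distrC v0).
have r0 : `|r| <= 3 / 2 by rewrite ger0_norm; lra.
have r1' : `|1 - r| <= t by rewrite ler_norml; lra.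
have := normr_ge0 (v - v0); have := normr_ge0 r; have := normr_ge0 v0.
have := normr_ge0 (1 - r).
by nra.
Qed.

End Chords.

(** * The unit sphere near a point *)

Section Sphere.
Context {R : realType} {Z : normedModType R} (phi : Z -> Z -> R).
Hypothesis phiP : forall u, supports (phi u) u.
Hypothesis gat : gateaux phi.
Implicit Types a b u v w x y e p s : Z.

Let phiL u : linear_form (phi u). Proof. by have [] := phiP u. Qed.
Let phiE u : phi u u = `|u|. Proof. by have [] := phiP u. Qed.
Let phi_le u x : phi u x <= `|x|. Proof. by have [] := phiP u. Qed.
Let phiD u x y : phi u (x + y) = phi u x + phi u y. Proof. exact: linear_formD. Qed.
Let phiB u x y : phi u (x - y) = phi u x - phi u y. Proof. exact: linear_formB. Qed.
Let phiN u x : phi u (- x) = - phi u x. Proof. exact: linear_formN. Qed.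
Let phiZ u (c : R) x : phi u (c *: x) = c * phi u x. Proof. exact: linear_formZ. Qed.

(** [gateaux] forces [g <= 0] on the kernel of [phi u], and replacing [e] by [- e] gives [g = 0]
    there. *)
Lemma supports_unique u (g : Z -> R) : u != 0 -> supports g u -> g =1 phi u.
Proof.
move=> u0 [gL gu gle].
have nu : 0 < `|u| by rewrite normr_gt0.
have half e : phi u e = 0 -> g e <= 0.
  move=> ue; apply/ler_addgt0Pl => eps eps0; rewrite addr0.
  have [t t0 ht] := gat u0 ue eps0.
  have := gle (u + t *: e); rewrite linear_formD // linear_formZ // gu => h.
  by rewrite -(ler_pM2l t0); lra.
move=> x; pose c := phi u x / `|u|; pose e := x - c *: u.
have ue : phi u e = 0 by rewrite phiB phiZ phiE divfK ?subrr // gt_eqF.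
have ge : g e = 0.
  apply/eqP; rewrite eq_le half //=; have := half (- e).
  by rewrite phiN ue linear_formN // oppr0 => /(_ erefl); lra.
have -> : x = e + c *: u by rewrite subrK.
by rewrite phiD ue linear_formD // ge phiZ linear_formZ // gu phiE.
Qed.

Lemma supports_scale (g : Z -> R) u (t : R) : 0 < t -> supports g u -> supports g (t *: u).
Proof.
by move=> t0 [gL gu gle]; split=> //; rewrite linear_formZ // gu normrZ gtr0_norm.
Qed.

Lemma support_scale u (t : R) : u != 0 -> 0 < t -> phi (t *: u) =1 phi u.
Proof.
move=> u0 t0 x; apply/esym; apply: supports_unique; last exact: supports_scale.
by rewrite scaler_eq0 negb_or u0 gt_eqF.
Qed.

Lemma quadratic_scale u (t : R) : u != 0 -> 0 < t ->
  quadratic_at phi u -> quadratic_at phi (t *: u).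
Proof.
move=> u0 t0 [C [eta [C0 eta0 hq]]].
exists (C / t), (t * eta); split.
- by rewrite divr_ge0 // ltW.
- by rewrite mulr_gt0.
move=> h hh; have nh : `|t^-1 *: h| < eta.
  by rewrite normrZ gtr0_norm ?invr_gt0 // mulrC ltr_pdivrMr // mulrC.
have := hq _ nh; rewrite phiZ normrZ (gtr0_norm (ltac:(by rewrite invr_gt0) : 0 < t^-1)).
rewrite -(ler_pM2l t0) support_scale // => le.
have -> : t *: u + h = t *: (u + t^-1 *: h).
  by rewrite scalerDr scalerA divff ?gt_eqF // scale1r.
rewrite !normrZ (gtr0_norm t0); apply: (le_trans le); rewrite le_eqVlt; apply/predU1P; left.
by field; rewrite gt_eqF.
Qed.

Lemma quadratic_dense_sphere p s (delta : R) : planar Z -> midpoint_convex Z ->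
  `|p| = 1 -> `|s| = 1 -> s != p -> 0 < delta ->
  exists s', [/\ `|s'| = 1, s' != p, `|s' - s| < delta & quadratic_at phi (p - s')].
Proof.
move=> pZ mc p1 s1 sp d0.
have [eta eta0 heta] := sphere_chord_near phiP mc p1 s1 sp d0.
have ps0 : p - s != 0 by rewrite subr_eq0 eq_sym.
have [w [w0 wd wq]] := quadratic_dense phiP pZ ps0 eta0.
have [s' [t [h1 h2 h3 h4]]] := heta w wd.
exists s'; split=> //; last by rewrite h4; exact: quadratic_scale.
by rewrite eq_sym -subr_eq0 h4 scaler_eq0 negb_or w0 gt_eqF.
Qed.

Lemma kernel_basis p : planar Z -> `|p| = 1 -> exists e,
  [/\ `|e| = 1, phi p e = 0, independent e p & spanning e p].
Proof.
move=> pZ p1; have p0 : p != 0 by rewrite -normr_gt0 p1.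
have [e0 ind0] := planar_independent pZ p0.
pose e1 := e0 - phi p e0 *: p.
have e10 : e1 != 0.
  apply/eqP => e10; have [|_ /eqP] := ind0 (- phi p e0) 1; last by rewrite oner_eq0.
  by rewrite scale1r scaleNr addrC.
have ne1 : 0 < `|e1| by rewrite normr_gt0.
pose e := `|e1|^-1 *: e1.
have e1n : `|e| = 1 by rewrite normrZ gtr0_norm ?invr_gt0 // mulVf // gt_eqF.
have pe : phi p e = 0 by rewrite phiZ phiB phiZ phiE p1 mulr1 subrr mulr0.
clearbody e; have ind : independent e p.
  move=> c d cd; have : phi p (c *: e + d *: p) = 0 by rewrite cd (linear_form0 (phiL p)).
  rewrite phiD !phiZ pe phiE p1 mulr0 add0r mulr1 => d0; split=> //.
  move: cd; rewrite d0 scale0r addr0 => /eqP.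
  by rewrite scaler_eq0 -[e == 0]normr_eq0 e1n oner_eq0 orbF => /eqP.
by exists e; split=> //; exact: pZ.2.
Qed.

(** The defect [1 - phi p x] is at most [(phi x - phi p) (x - p)], which is [o(|x - p|)] by
    continuity of the support map. *)
Lemma sphere_flat p : planar Z -> `|p| = 1 -> forall eps : R, 0 < eps ->
  exists2 delta : R, 0 < delta & forall x, `|x| = 1 -> `|x - p| < delta ->
    1 - phi p x <= eps * `|x - p|.
Proof.
move=> pZ p1 eps eps0; have p0 : p != 0 by rewrite -normr_gt0 p1.
have [e [e1 pe ind sp]] := kernel_basis pZ p1.
have [c c0 hc] := coordinates_bound phiP ind.
have ec0 : 0 < eps / (2 * c) by rewrite divr_gt0 // mulr_gt0.
have [d1 d10 h1] := continuous_support phiP gat e p0 ec0.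
have [d2 d20 h2] := continuous_support phiP gat p p0 ec0.
exists (Num.min d1 d2) => [|x x1]; first by rewrite lt_min d10.
rewrite lt_min => /andP[xd1 xd2].
have {}h1 := h1 x xd1; have {}h2 := h2 x xd2.
have [A [B E]] := sp (x - p); have [hA hB] := hc A B; rewrite -E in hA hB.
have h3 : 1 - phi p x <= phi x (x - p) - phi p (x - p).
  by rewrite !phiB !phiE x1 p1; have := phi_le x p; rewrite p1; lra.
apply: (le_trans h3).
have -> : phi x (x - p) - phi p (x - p) =
    A * (phi x e - phi p e) + B * (phi x p - phi p p).
  by rewrite E !phiD !phiZ; ring.
apply: (le_trans (ler_norm _)); apply: (le_trans (ler_normD _ _)); rewrite !normrM.
have nx := normr_ge0 (x - p).
have key (a d : R) : `|a| <= c * `|x - p| -> `|d| < eps / (2 * c) ->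
    `|a| * `|d| <= eps / 2 * `|x - p|.
  move=> ha hd; apply: (le_trans (ler_pM _ _ ha (ltW hd))) => //.
  by rewrite le_eqVlt; apply/predU1P; left; field; rewrite gt_eqF.
by have := key _ _ hA h1; have := key _ _ hB h2; lra.
Qed.

Lemma sphere_coords p e x : `|p| = 1 -> `|e| = 1 -> phi p e = 0 -> spanning e p ->
  `|x| = 1 -> exists tau : R, x - p = tau *: e - (1 - phi p x) *: p /\
    `| `|tau| - `|x - p| | <= 1 - phi p x.
Proof.
move=> p1 e1 pe sp x1; have [A [B E]] := sp (x - p).
have : phi p (x - p) = B by rewrite E phiD !phiZ pe phiE p1 mulr0 add0r mulr1.
rewrite phiB phiE p1 => hB; have B0 : B <= 0 by rewrite -hB; have := phi_le p x; lra.
have BE : 1 - phi p x = - B by lra.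
exists A; split; first by rewrite BE scaleNr opprK.
have -> : `|A| = `|A *: e| by rewrite normrZ e1 mulr1.
have -> : A *: e = x - p - B *: p by rewrite E addrK.
apply: (le_trans (ler_dist_dist _ _)).
by rewrite addrAC subrr add0r normrN normrZ p1 mulr1 ler0_norm // BE.
Qed.

End Sphere.

(** Chords from [p] reach only the directions of an open half-space. Symmetry gives the opposite
    one, and [z + r p] with small [r] gives the hyperplane between them. *)
Lemma norm_le_of_half_space {R : realType} (Z W : normedModType R) (g : Z -> R)
    (T : {linear Z -> W}) (p : Z) : linear_form g -> g p = 1 ->
  (forall z, 0 < g z -> `|z| <= `|T z|) -> forall z, `|z| <= `|T z|.
Proof.
move=> gL gp half z; have [gz|gz|gz] := ltgtP (g z) 0.
- by have := half (- z); rewrite linear_formN // oppr_gt0 raddfN !normrN => /(_ gz).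
- exact: half.
apply/ler_addgt0Pr => eps eps0.
have c0 : 0 < `|p| + `|T p| + 1 by rewrite ltr_wpDl // addr_ge0.
have [r r0 rE] : exists2 r : R, 0 < r & r * (`|p| + `|T p| + 1) = eps.
  by exists (eps / (`|p| + `|T p| + 1)); [rewrite divr_gt0|rewrite divfK // gt_eqF].
have := half (z + r *: p); rewrite linear_formD // linear_formZ // gz gp mulr1 add0r.
move=> /(_ r0); rewrite raddfD /= linearZ_LR => h.
have := ler_normD (T z) (r *: T p); have := lerB_normD z (r *: p).
by rewrite !normrZ gtr0_norm // => h1 h2; lra.
Qed.

Lemma compact_subsequence {R : realType} (M : pseudoMetricType R) (K : set M) (u : nat -> M) :
  compact K -> (forall n, K (u n)) -> exists2 c, K c &
    forall (eps : R) (N : nat), 0 < eps -> exists2 n, (N <= n)%N & ball c eps (u n).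
Proof.
move=> cK uK; have [|c [Kc clu]] := cK (u @ \oo) _; first by exists 0%N => // n _; exact: uK.
exists c => // eps N eps0.
have [|_ [[n Nn <-] hn]] := clu [set v | exists2 n, (N <= n)%N & u n = v] (ball c eps) _
  (nbhsx_ballx _ _ eps0); last by exists n.
by exists N => // n /= Nn; exists n.
Qed.

Lemma cube_subsequence {R : realType} (u : nat -> R * R * R) :
  (forall n, [/\ `|(u n).1.1| <= 1, `|(u n).1.2| <= 1 & `|(u n).2| <= 1]) ->
  exists a b c : R, forall (eps : R) (N : nat), 0 < eps -> exists n, [/\ (N <= n)%N,
    `|(u n).1.1 - a| < eps, `|(u n).1.2 - b| < eps & `|(u n).2 - c| < eps].
Proof.
move=> hu; have cI := @segment_compact R (-1) 1.
have [|[[a b] c] _ h] := compact_subsequence (compact_setX (compact_setX cI cI) cI) (u := u).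
  by move=> n; have [h1 h2 h3] := hu n; rewrite /= !in_itv /= -!ler_norml.
exists a, b, c => eps N eps0; have [n Nn [[/= h1 h2] h3]] := h eps N eps0.
by exists n; split=> //; rewrite distrC.
Qed.

(** * Extension of an isometry at a non-quadratic point *)

Section Extension.
Context {R : realType} {X Y : normedModType R}.
Variables (phi : X -> X -> R) (psi : Y -> Y -> R) (f : X -> Y) (p : X).
Hypotheses (phiP : forall u, supports (phi u) u) (psiP : forall u, supports (psi u) u).
Hypotheses (gatX : gateaux phi) (gatY : gateaux psi).
Hypotheses (planarX : planar X) (planarY : planar Y).
Hypotheses (mcX : midpoint_convex X) (mcY : midpoint_convex Y).
Hypothesis f_sphere : forall x, `|x| = 1 -> `|f x| = 1.
Hypothesis f_isom : forall x y, `|x| = 1 -> `|y| = 1 -> `|f x - f y| = `|x - y|.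
Hypothesis f_onto : forall y, `|y| = 1 -> exists2 x, `|x| = 1 & f x = y.
Hypothesis f_odd : forall x, `|x| = 1 -> f (- x) = - f x.
Hypothesis p1 : `|p| = 1.

Let phiL u : linear_form (phi u). Proof. by have [] := phiP u. Qed.
Let phiE u : phi u u = `|u|. Proof. by have [] := phiP u. Qed.
Let phi_le u x : phi u x <= `|x|. Proof. by have [] := phiP u. Qed.
Let phiD u x y : phi u (x + y) = phi u x + phi u y. Proof. exact: linear_formD. Qed.
Let phiB u x y : phi u (x - y) = phi u x - phi u y. Proof. exact: linear_formB. Qed.
Let phiN u x : phi u (- x) = - phi u x. Proof. exact: linear_formN. Qed.
Let phiZ u (c : R) x : phi u (c *: x) = c * phi u x. Proof. exact: linear_formZ. Qed.
Let psiL u : linear_form (psi u). Proof. by have [] := psiP u. Qed.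
Let psiE u : psi u u = `|u|. Proof. by have [] := psiP u. Qed.
Let psi_le u x : psi u x <= `|x|. Proof. by have [] := psiP u. Qed.
Let psiD u x y : psi u (x + y) = psi u x + psi u y. Proof. exact: linear_formD. Qed.
Let psiB u x y : psi u (x - y) = psi u x - psi u y. Proof. exact: linear_formB. Qed.
Let psiZ u (c : R) x : psi u (c *: x) = c * psi u x. Proof. exact: linear_formZ. Qed.
Let fp1 : `|f p| = 1. Proof. exact: f_sphere. Qed.

Let opp_p_neq : - p != p.
Proof.
rewrite -subr_eq0 -opprD oppr_eq0 -mulr2n -scaler_nat.
by rewrite scaler_eq0 pnatr_eq0 /= -normr_eq0 p1 oner_eq0.
Qed.

Let twice (V : lmodType R) (v : V) : v - (- v) = 2 *: v.
Proof. by rewrite opprK scaler_nat. Qed.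

Let f_neq s : `|s| = 1 -> s != p -> f s != f p.
Proof.
by move=> s1; apply: contraNneq => fs; rewrite -subr_eq0 -normr_eq0 -f_isom // fs subrr normr0.
Qed.

(** [C] and [eta] are explicit arguments because they vary with [s]: the inequality itself does not
    survive a limit in [s], only what is deduced from it as [x] tends to [p]. *)
Definition dominates_domain s (C eta : R) := forall x, `|x| = 1 -> `|x - p| < eta ->
  psi (f p - f s) (f x - f p) <= phi (p - s) (x - p) + C * `|x - p| ^+ 2.

Definition dominates_codomain s (C eta : R) := forall x, `|x| = 1 -> `|x - p| < eta ->
  phi (p - s) (x - p) <= psi (f p - f s) (f x - f p) + C * `|x - p| ^+ 2.

(* [`|x - s|] is at most its second-order expansion at [x = p], while
   [`|f x - f s|] is at least its first-order expansion, by convexity. *)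
Lemma quadratic_dominates_domain s : `|s| = 1 -> quadratic_at phi (p - s) ->
  exists C eta : R, [/\ 0 <= C, 0 < eta & dominates_domain s C eta].
Proof.
move=> s1 [C [eta [C0 eta0 hq]]]; exists C, eta; split=> // x x1 xd.
have := hq _ xd; rewrite [p - s + _]addrC addrA subrK => h1.
have := psi_le (f p - f s) (f x - f p + (f p - f s)).
by rewrite psiD psiE addrA subrK !f_isom //; lra.
Qed.

Lemma quadratic_dominates_codomain s : `|s| = 1 -> quadratic_at psi (f p - f s) ->
  exists C eta : R, [/\ 0 <= C, 0 < eta & dominates_codomain s C eta].
Proof.
move=> s1 [C [eta [C0 eta0 hq]]]; exists C, eta; split=> // x x1 xd.
have := hq (f x - f p); rewrite !f_isom // => /(_ xd).
rewrite [f p - f s + _]addrC addrA subrK f_isom // => h1.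
have := phi_le (p - s) (x - p + (p - s)).
by rewrite phiD phiE addrA subrK; lra.
Qed.

(** * The comparison relative to fixed tangent directions *)

Section Directions.
Variables (e : X) (e' : Y).
Hypotheses (e1 : `|e| = 1) (pe : phi p e = 0) (inde : independent e p) (spe : spanning e p).
Hypotheses (e1' : `|e'| = 1) (inde' : independent e' (f p)).
(** [s] and [s'] are the radial defects at [p] and [f p]. The signs of [e] and [e'] are to be chosen
    so that both tangential coordinates are close to [|x - p|] rather than to its opposite; the
    bound with [K] is where non-quadraticity of [p] enters. *)
Hypothesis approach : forall eps K : R, 0 < eps -> 0 < K -> exists x (t t' s s' : R),
  [/\ `|x| = 1, 0 < `|x - p|, `|x - p| < eps,
      x - p = t *: e - s *: p & f x - f p = t' *: e' - s' *: f p] /\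
  [/\ s <= eps * `|x - p|, s' <= eps * `|x - p|, K * `|x - p| ^+ 2 < s,
      `|t - `|x - p| | <= s & `|t' - `|x - p| | <= s'].

Let alpha s := phi (p - s) e.
Let beta s := phi (p - s) p.
Let alpha' s := psi (f p - f s) e'.
Let beta' s := psi (f p - f s) (f p).

Let alpha_le s : `|alpha s| <= 1. Proof. rewrite -e1; exact: (supports_norm e (phiP (p - s))). Qed.
Let beta_le s : `|beta s| <= 1. Proof. rewrite -p1; exact: (supports_norm p (phiP (p - s))). Qed.
Let alpha'_le s : `|alpha' s| <= 1. Proof. rewrite -e1'; exact: (supports_norm e' (psiP (f p - f s))). Qed.
Let beta'_le s : `|beta' s| <= 1. Proof. rewrite -fp1; exact: (supports_norm (f p) (psiP (f p - f s))). Qed.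

(** The four values are continuous in [s] away from [p], those in Y because [f] is isometric, so a
    linear inequality between them may be checked on a dense set. *)
Lemma nonneg_of_dense (G : X -> Prop) (a b c d : R) :
  (forall s (delta : R), `|s| = 1 -> s != p -> 0 < delta ->
    exists s', [/\ `|s'| = 1, s' != p, `|s' - s| < delta & G s']) ->
  (forall s, `|s| = 1 -> s != p -> G s ->
    0 <= a * alpha s + b * beta s + c * alpha' s + d * beta' s) ->
  forall s, `|s| = 1 -> s != p ->
    0 <= a * alpha s + b * beta s + c * alpha' s + d * beta' s.
Proof.
move=> dense pos s s1 sp; rewrite leNgt; apply/negP.
set v := a * _ + _ + _ + _ => v0.
(* The extra 1 makes the total error at most [(n - 1) (- v / n)], strictly less than [- v]. *)
pose n := `|a| + `|b| + `|c| + `|d| + 1.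
have n0 : 0 < n by rewrite ltr_wpDl // !addr_ge0.
have eps0 : 0 < - v / n by rewrite divr_gt0 //; lra.
have ps : p - s != 0 by rewrite subr_eq0 eq_sym.
have fps : f p - f s != 0 by rewrite subr_eq0 eq_sym f_neq.
have [d1 d10 h1] := continuous_support phiP gatX e ps eps0.
have [d2 d20 h2] := continuous_support phiP gatX p ps eps0.
have [d3 d30 h3] := continuous_support psiP gatY e' fps eps0.
have [d4 d40 h4] := continuous_support psiP gatY (f p) fps eps0.
have [|s' [s'1 s'p s's Gs']] := dense s (Num.min (Num.min d1 d2) (Num.min d3 d4)) s1 sp.
  by rewrite !lt_min d10 d20 d30.
move: s's; rewrite !lt_min => /andP[/andP[l1 l2] /andP[l3 l4]].
have distX : `|p - s' - (p - s)| = `|s' - s|.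
  by rewrite opprB addrC addrA subrK distrC.
have distY : `|f p - f s' - (f p - f s)| = `|s' - s|.
  by rewrite opprB addrC addrA subrK distrC f_isom.
have {}h1 : `|alpha s' - alpha s| < - v / n by apply: h1; rewrite distX.
have {}h2 : `|beta s' - beta s| < - v / n by apply: h2; rewrite distX.
have {}h3 : `|alpha' s' - alpha' s| < - v / n by apply: h3; rewrite distY.
have {}h4 : `|beta' s' - beta' s| < - v / n by apply: h4; rewrite distY.
have step (k x y : R) : `|x - y| < - v / n -> k * x - k * y <= `|k| * (- v / n).
  move=> hxy; rewrite -mulrBr (le_trans (ler_norm _)) // normrM.
  by rewrite ler_wpM2l // ltW.
have := step a _ _ h1; have := step b _ _ h2; have := step c _ _ h3.
have := step d _ _ h4; have := pos s' s'1 s'p Gs'.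
have : (n - 1) * (- v / n) + (- v / n) = - v by field; rewrite gt_eqF.
by rewrite /n /v in eps0 *; lra.
Qed.

Lemma dense_domain s (delta : R) : `|s| = 1 -> s != p -> 0 < delta ->
  exists s', [/\ `|s'| = 1, s' != p, `|s' - s| < delta &
    exists C eta : R, [/\ 0 <= C, 0 < eta & dominates_domain s' C eta]].
Proof.
move=> s1 sp d0.
have [s' [h1 h2 h3 h4]] := quadratic_dense_sphere phiP gatX planarX mcX p1 s1 sp d0.
by exists s'; split=> //; exact: quadratic_dominates_domain.
Qed.

(** The quadratic chords are found in Y and pulled back by surjectivity of [f]; they may be
    unrelated to the quadratic chords of X. *)
Lemma dense_codomain s (delta : R) : `|s| = 1 -> s != p -> 0 < delta ->
  exists s', [/\ `|s'| = 1, s' != p, `|s' - s| < delta &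
    exists C eta : R, [/\ 0 <= C, 0 < eta & dominates_codomain s' C eta]].
Proof.
move=> s1 sp d0.
have [y [h1 h2 h3 h4]] := quadratic_dense_sphere psiP gatY planarY mcY fp1
  (f_sphere s1) (f_neq s1 sp) d0.
have [s' s'1 fs'] := f_onto h1; rewrite -fs' in h2 h3 h4.
exists s'; split=> //; last exact: quadratic_dominates_codomain.
- by apply: contraNneq h2 => ->.
- by rewrite -f_isom.
Qed.

Lemma first_order s (eps : R) : 0 < eps -> exists x, [/\ `|x| = 1, 0 < `|x - p|, `|x - p| < eps,
  `|phi (p - s) (x - p) - `|x - p| * alpha s| <= 2 * (eps * `|x - p|) &
  `|psi (f p - f s) (f x - f p) - `|x - p| * alpha' s| <= 2 * (eps * `|x - p|)].
Proof.
move=> eps0.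
have [x [t [t' [sg [sg' [[x1 d0 deps E E'] [h1 h2 _ h4 h5]]]]]]] := approach eps0 ltr01.
exists x; set d := `|x - p| in d0 deps h1 h2 h4 h5 *.
have bound (r sr y z : R) : `|r - d| <= sr -> sr <= eps * d -> `|y| <= 1 -> `|z| <= 1 ->
    `|r * y - sr * z - d * y| <= 2 * (eps * d).
  move=> rd sd y1 z1; have sr0 : 0 <= sr by apply: le_trans rd.
  have -> : r * y - sr * z - d * y = (r - d) * y - sr * z by ring.
  rewrite (le_trans (ler_normB _ _)) // !normrM (ger0_norm sr0).
  have := ler_piMr (normr_ge0 (r - d)) y1; have := ler_piMr sr0 z1; lra.
split=> //.
  by rewrite E phiB !phiZ; exact: (bound _ _ _ _ h4 h1 (alpha_le s) (beta_le s)).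
by rewrite E' psiB !psiZ; exact: (bound _ _ _ _ h5 h2 (alpha'_le s) (beta'_le s)).
Qed.

(** Divide the comparisons by [|x - p|] and let [x] tend to [p]: one gives [alpha <= alpha'], the
    other the converse, each on its own dense set and then everywhere. *)
Lemma alphaE s : `|s| = 1 -> s != p -> alpha s = alpha' s.
Proof.
(* The 4 collects two errors [2 eps] from [first_order]; [C eps] bounds the quadratic term after
   division by [|x - p|]. *)
have limit (a b C eta : R) : 0 <= C -> 0 < eta ->
    (forall eps : R, 0 < eps -> eps < eta -> a <= b + (4 + C) * eps) -> a <= b.
  move=> C0 eta0 h; apply/ler_addgt0Pr => eps eps0.
  have C4 : 0 < 4 + C by lra.
  pose e0 : R := Num.min (eta / 2) (eps / (4 + C)).
  have e00 : 0 < e0 by rewrite lt_min !divr_gt0.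
  have e0eta : e0 < eta by rewrite gt_min; apply/orP; left; lra.
  have e0eps : e0 <= eps / (4 + C) by rewrite ge_min lexx orbT.
  apply: (le_trans (h _ e00 e0eta)); rewrite lerD2l mulrC.
  by rewrite ler_pdivlMr // in e0eps.
move=> s1 sp; apply/eqP; rewrite eq_le; apply/andP; split.
- have := nonneg_of_dense (a := -1) (b := 0) (c := 1) (d := 0) dense_codomain.
  move=> /(_ _ s s1 sp); rewrite !mul0r; suff H : forall s, `|s| = 1 -> s != p ->
      (exists C eta : R, [/\ 0 <= C, 0 < eta & dominates_codomain s C eta]) ->
      0 <= -1 * alpha s + 0 * beta s + 1 * alpha' s + 0 * beta' s.
    by move=> /(_ H); lra.
  move=> {s1 sp}s s1 sp [C [eta [C0 eta0 dom]]].
  suff : alpha s <= alpha' s by lra.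
  apply: (limit _ _ C eta) => // eps eps0 epseta.
  have [x [x1 d0 deps hphi hpsi]] := first_order s eps0.
  have := dom x x1 (lt_trans deps epseta); have := ler_wpM2l C0 (ler_wpM2r (ltW d0) (ltW deps)).
  move: hphi hpsi; rewrite !ler_norml => /andP[h1 _] /andP[_ h2] h3 h4.
  by rewrite -(ler_pM2l d0); lra.
- have := nonneg_of_dense (a := 1) (b := 0) (c := -1) (d := 0) dense_domain.
  move=> /(_ _ s s1 sp); rewrite !mul0r; suff H : forall s, `|s| = 1 -> s != p ->
      (exists C eta : R, [/\ 0 <= C, 0 < eta & dominates_domain s C eta]) ->
      0 <= 1 * alpha s + 0 * beta s + -1 * alpha' s + 0 * beta' s.
    by move=> /(_ H); lra.
  move=> {s1 sp}s s1 sp [C [eta [C0 eta0 dom]]].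
  suff : alpha' s <= alpha s by lra.
  apply: (limit _ _ C eta) => // eps eps0 epseta.
  have [x [x1 d0 deps hphi hpsi]] := first_order s eps0.
  have := dom x x1 (lt_trans deps epseta); have := ler_wpM2l C0 (ler_wpM2r (ltW d0) (ltW deps)).
  move: hphi hpsi; rewrite !ler_norml => /andP[_ h1] /andP[h2 _] h3 h4.
  by rewrite -(ler_pM2l d0); lra.
Qed.

(** As [alpha = alpha'], the comparisons bound one and the same combination of [alpha], [beta],
    [beta'] from below and from above. Its coefficients are those of [x], common to all [s], so a
    cluster point of the normalized coefficients gives a single relation. *)
Lemma linear_relation : exists a b c : R, [\/ a != 0, b != 0 | c != 0] /\
  forall s, `|s| = 1 -> s != p -> a * alpha s + b * beta s + c * beta' s = 0.
Proof.
have /choice[w hw] : forall n : nat, exists w : R * R * R,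
    [/\ `|w.1.1| <= 1, `|w.1.2| <= 1, `|w.2| <= 1,
        [\/ `|w.1.1| = 1, `|w.1.2| = 1 | `|w.2| = 1] &
        forall s (C eta : R), `|s| = 1 -> s != p -> 0 <= C -> n.+1%:R^-1 < eta ->
          (dominates_domain s C eta -> - (C / n.+1%:R) <=
            w.1.1 * alpha s + w.1.2 * beta s + w.2 * beta' s) /\
          (dominates_codomain s C eta -> w.1.1 * alpha s + w.1.2 * beta s +
            w.2 * beta' s <= C / n.+1%:R)].
  move=> n; have n0 : 0 < n.+1%:R :> R by [].
  have ni0 : 0 < n.+1%:R^-1 :> R by rewrite invr_gt0.
  have [x [t [t' [sg [sg' [[x1 d0 deps E E'] [h1 h2 h3 h4 h5]]]]]]] := approach ni0 n0.
  set d := `|x - p| in d0 deps h1 h2 h3 h4 h5 *.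
  have sg0 : 0 < sg.
    by apply: le_lt_trans h3; rewrite mulr_ge0 ?exprn_ge0 // ltW.
  have sg'0 : 0 <= sg' by apply: le_trans h5.
  (* [M] is the largest coefficient in absolute value. As [M >= sg], the choice [K = n.+1] gives
     [C d^2 / M <= C / n.+1]. *)
  pose M : R := Num.max (Num.max `|t - t'| sg) sg'.
  have M1 : `|t - t'| <= M by rewrite !le_max lexx.
  have M2 : sg <= M by rewrite !le_max lexx orbT.
  have M3 : sg' <= M by rewrite le_max lexx orbT.
  have M0 : 0 < M by apply: lt_le_trans M2.
  have nM : `|M^-1| = M^-1 by rewrite gtr0_norm // invr_gt0.
  exists ((t - t') / M, - sg / M, sg' / M); split=> /=.
  - by rewrite normrM nM ler_pdivrMr // mul1r.
  - by rewrite normrM nM ler_pdivrMr // mul1r normrN gtr0_norm.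
  - by rewrite normrM nM ler_pdivrMr // mul1r ger0_norm.
  - rewrite !normrM nM normrN (gtr0_norm sg0) (ger0_norm sg'0).
    have Mi : [\/ M = `|t - t'|, M = sg | M = sg'].
      rewrite /M; case: (leP (Num.max _ _) sg') => [_|_]; first by constructor 3.
      by case: (leP `|_| sg) => _; [constructor 2|constructor 1].
    by case: Mi => Mi; [constructor 1|constructor 2|constructor 3];
      rewrite -Mi divff // gt_eqF.
  - move=> s C eta s1 sp C0 neta.
    have dsmall : C * d ^+ 2 <= C / n.+1%:R * M.
      rewrite -mulrA ler_wpM2l // ler_pdivlMl //.
      by apply: (le_trans (ltW h3)).
    have xeta : d < eta by apply: lt_trans neta.
    have relE : (t - t') / M * alpha s + - sg / M * beta s + sg' / M * beta' s =
        ((t - t') * alpha s - sg * beta s + sg' * beta' s) / M by ring.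
    split=> dom; have := dom x x1 xeta; rewrite -/d E E' !phiB !phiZ !psiB !psiZ;
      rewrite -/(alpha s) -/(beta s) -/(alpha' s) -/(beta' s) -alphaE // relE => h.
    + by rewrite ler_pdivlMr // mulNr; move: dsmall; set k := C / _; lra.
    + by rewrite ler_pdivrMr //; move: dsmall; set k := C / _; lra.
have [|a [b [c clu]]] := cube_subsequence (u := w).
  by move=> n; have [] := hw n.
exists a, b, c; split.
  apply: contrapT => no.
  have a0 : a = 0 by apply: contrapT => /eqP h; apply: no; constructor 1.
  have b0 : b = 0 by apply: contrapT => /eqP h; apply: no; constructor 2.
  have c0 : c = 0 by apply: contrapT => /eqP h; apply: no; constructor 3.
  (* Each triple has a coordinate of absolute value 1, so the origin cannot be a cluster point. *)
  have [n [_ w1 w2 w3]] := clu 1 0%N ltr01.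
  rewrite a0 b0 c0 !subr0 in w1 w2 w3; have [_ _ _ wmax _] := hw n.
  by case: wmax => h; move: w1 w2 w3; rewrite h ltxx.
pose V s := a * alpha s + b * beta s + c * beta' s.
have approx s (C eta eps : R) : 0 <= C -> 0 < eta -> 0 < eps -> exists n, [/\
    n.+1%:R^-1 < eta, C / n.+1%:R <= eps &
    `|(w n).1.1 * alpha s + (w n).1.2 * beta s + (w n).2 * beta' s - V s| <= 3 * eps].
  move=> C0 eta0 eps0; pose m : R := Num.min eta (eps / (C + 1)).
  have C1 : 0 < C + 1 by lra.
  have m0 : 0 < m by rewrite lt_min eta0 divr_gt0.
  have [n [Nn w1 w2 w3]] := clu eps (Num.bound m^-1) eps0; exists n.
  have nm : n.+1%:R^-1 < m.
    rewrite invf_plt ?posrE //; apply: (lt_trans (archi_boundP _)).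
      by rewrite invr_ge0 ltW.
    by rewrite ltr_nat ltnS.
  move: nm; rewrite lt_min => /andP[l1]; rewrite ltr_pdivlMr // => l2; split=> //.
    by apply: (le_trans _ (ltW l2)); rewrite mulrC ler_wpM2l ?invr_ge0 // lerDl.
  have -> : (w n).1.1 * alpha s + (w n).1.2 * beta s + (w n).2 * beta' s - V s =
      ((w n).1.1 - a) * alpha s + ((w n).1.2 - b) * beta s + ((w n).2 - c) * beta' s.
    by rewrite /V; ring.
  have step (g h : R) : `|g| < eps -> `|h| <= 1 -> `|g * h| <= eps.
    by move=> g1 h1; rewrite normrM -[leRHS]mulr1 ler_pM // ltW.
  have := step _ _ w1 (alpha_le s); have := step _ _ w2 (beta_le s).
  have := step _ _ w3 (beta'_le s); set z := _ * beta' s; set y := _ * beta s.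
  have := ler_normD (((w n).1.1 - a) * alpha s + y) z.
  by have := ler_normD (((w n).1.1 - a) * alpha s) y; lra.
move=> s s1 sp; apply/eqP; rewrite eq_le; apply/andP; split.
- have := nonneg_of_dense (a := - a) (b := - b) (c := 0) (d := - c) dense_codomain.
  move=> /(_ _ s s1 sp); suff H : forall s, `|s| = 1 -> s != p ->
      (exists C eta : R, [/\ 0 <= C, 0 < eta & dominates_codomain s C eta]) ->
      0 <= - a * alpha s + - b * beta s + 0 * alpha' s + - c * beta' s.
    by move=> /(_ H); lra.
  move=> {s1 sp}s s1 sp [C [eta [C0 eta0 dom]]].
  suff : V s <= 0 by rewrite /V; lra.
  apply/ler_addgt0Pr => eps eps0; have eps4 : 0 < eps / 4 by lra.
  have [n [l1 l2]] := approx s C eta (eps / 4) C0 eta0 eps4.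
  have [_ _ _ _ /(_ s C eta s1 sp C0 l1)[_ /(_ dom) hd]] := hw n.
  by have {hd l2} := le_trans hd l2; rewrite ler_norml => h /andP[]; lra.
- have := nonneg_of_dense (a := a) (b := b) (c := 0) (d := c) dense_domain.
  move=> /(_ _ s s1 sp); suff H : forall s, `|s| = 1 -> s != p ->
      (exists C eta : R, [/\ 0 <= C, 0 < eta & dominates_domain s C eta]) ->
      0 <= a * alpha s + b * beta s + 0 * alpha' s + c * beta' s.
    by move=> /(_ H); lra.
  move=> {s1 sp}s s1 sp [C [eta [C0 eta0 dom]]].
  suff : 0 <= V s by rewrite /V; lra.
  apply/ler_addgt0Pr => eps eps0; have eps4 : 0 < eps / 4 by lra.
  have [n [l1 l2]] := approx s C eta (eps / 4) C0 eta0 eps4.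
  have [_ _ _ _ /(_ s C eta s1 sp C0 l1)[/(_ dom) hd _]] := hw n.
  have l3 : - (eps / 4) <= - (C / n.+1%:R) by rewrite lerN2.
  by have {hd l2 l3} := le_trans l3 hd; rewrite ler_norml => h /andP[]; lra.
Qed.

Lemma support_antipode : alpha (- p) = 0 /\ beta (- p) = 1 /\ beta' (- p) = 1.
Proof.
have p0 : p != 0 by rewrite -normr_gt0 p1.
have fp0 : f p != 0 by rewrite -normr_gt0 fp1.
rewrite /alpha /beta /beta' f_odd // !twice.
by rewrite !(support_scale phiP gatX) // (support_scale psiP gatY) // phiE psiE.
Qed.

(** If [alpha] vanished, [|p - e|] and [|p + e|] would be values of support functionals at [p],
    hence at most 1, and [p] would be the midpoint of two distinct points of the ball. *)
Lemma alpha_nonzero : exists2 s, `|s| = 1 /\ s != p & alpha s != 0.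
Proof.
apply: contrapT => no.
have zero s : `|s| = 1 -> s != p -> alpha s = 0.
  by move=> s1 sp; apply: contrapT => /eqP h; apply: no; exists s.
have ep : e != p by apply/eqP => ep; move: pe; rewrite ep phiE p1 => /eqP; rewrite oner_eq0.
have nep : - e != p.
  by apply/eqP => ep'; move: pe; rewrite -[e]opprK ep' phiN phiE p1 => /eqP; rewrite oppr_eq0 oner_eq0.
have h1 : `|p - e| <= 1.
  have := zero e e1 ep; rewrite /alpha => z.
  have := phi_le (p - e) p; have := phiE (p - e).
  by rewrite {1}phiB z p1; lra.
have h2 : `|p + e| <= 1.
  have := zero (- e) (etrans (normrN _) e1) nep; rewrite /alpha opprK => z.
  have := phi_le (p + e) p; have := phiE (p + e).
  by rewrite {1}phiD z p1; lra.
have ne : p - e != p + e.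
  apply/eqP => /addrI /eqP; rewrite -subr_eq0 -opprD oppr_eq0 -mulr2n -scaler_nat.
  by rewrite scaler_eq0 pnatr_eq0 /= -normr_eq0 e1 oner_eq0.
have := norm_between_lt1 (t := 1 / 2) phiP mcX h1 h2 ne (ltac:(lra)).
have -> : 1 / 2 *: (p - e) + (1 - 1 / 2) *: (p + e) = p.
  have -> : 1 - 1 / 2 = 1 / 2 :> R by lra.
  rewrite -scalerDr addrACA addNr addr0 -[p + p]mulr2n -[p *+ 2]scaler_nat scalerA.
  have -> : 1 / 2 * 2 = 1 :> R by lra.
  by rewrite scale1r.
by rewrite p1 ltxx.
Qed.

(** At [s = - p] the relation reads [b + c = 0]; then [b = 0] would leave [a alpha = 0] for all
    [s]. *)
Lemma beta'E : exists k : R, forall s, `|s| = 1 -> s != p -> beta' s = beta s + k * alpha s.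
Proof.
have [a [b [c [abc rel]]]] := linear_relation.
have bc : c = - b.
  have := rel (- p) (etrans (normrN _) p1) opp_p_neq; have [-> [-> ->]] := support_antipode.
  by lra.
have b0 : b != 0.
  apply/eqP => b0; rewrite bc b0 oppr0 in rel abc.
  have a0 : a != 0 by case: abc; rewrite ?eqxx.
  have [s [s1 sp]] := alpha_nonzero; apply/negP; rewrite negbK.
  have := rel s s1 sp; rewrite !mul0r !addr0 => /eqP.
  by rewrite mulf_eq0 (negbTE a0).
exists (a / b) => s s1 sp; have := rel s s1 sp; rewrite bc => h.
apply: (mulfI b0); rewrite mulrDr mulrCA mulrA divfK //.
by lra.
Qed.

Lemma linear_extension_directions : exists F : {linear X -> Y},
  [/\ forall x, `|F x| = `|x|, forall y, exists x, F x = y &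
    forall s, `|s| = 1 -> F s = f s].
Proof.
have [k hk] := beta'E.
have [A [B [lA lB AB]]] := coordinates inde spe.
(* [q] is the intended image of [p]: since [alpha' = alpha], subtracting [k e'] makes
   [psi (f p - f s) q] equal to [beta s]. *)
pose q := f p - k *: e'.
have indq : independent e' q.
  move=> a b; rewrite /q scalerBr addrCA scalerA -scalerBl addrC => /inde'[h b0].
  by move: h; rewrite b0 mul0r subr0.
have [A' [B' [lA' lB' AB']]] := coordinates indq (planarY.2 _ _ indq).
pose T x := A x *: e' + B x *: q.
pose S y := A' y *: e + B' y *: p.
have linT : linear T.
  by move=> a x y; rewrite /T lA lB !scalerDl [a *: (_ + _)]scalerDr !scalerA addrACA.
have linS : linear S.
  by move=> a x y; rewrite /S lA' lB' !scalerDl [a *: (_ + _)]scalerDr !scalerA addrACA.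
pose F : {linear X -> Y} := HB.pack T (GRing.isLinear.Build R X Y *:%R T linT).
have TS y : T (S y) = y.
  have [|hA hB] := @inde (A (S y) - A' y) (B (S y) - B' y).
    by rewrite !scalerBl addrACA -opprD -AB subrr.
  have -> : T (S y) = A' y *: e' + B' y *: q.
    by rewrite /T; congr (_ *: _ + _ *: _); lra.
  by rewrite -AB'.
have psiT s x : `|s| = 1 -> s != p -> psi (f p - f s) (T x) = phi (p - s) x.
  move=> s1 sp; rewrite [in RHS](AB x) /T phiD !phiZ psiD !psiZ psiB psiZ.
  rewrite -/(alpha s) -/(beta s) -/(alpha' s) -/(beta' s) -alphaE // hk //.
  by ring.
have p0 : p != 0 by rewrite -normr_gt0 p1.
pose E : {linear Y -> X} := HB.pack S (GRing.isLinear.Build R Y X *:%R S linS).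
have TZ a x : T (a *: x) = a *: T x by exact: (linearZ_LR F).
have TD x y : T (x + y) = T x + T y by exact: (raddfD F).
have TN x : T (- x) = - T x by exact: (raddfN F).
have SZ a x : S (a *: x) = a *: S x by exact: (linearZ_LR E).
(* Up to scale [z] is a chord [p - s], where [phi (p - s)] attains the norm; by [psiT] that value is
   also taken by [psi (f p - f s)] at [T z]. The bound for the inverse is obtained in the same way
   from chords of Y. *)
have le_T : forall x, `|x| <= `|F x|.
  apply: (norm_le_of_half_space (phiL p) (etrans (phiE p) p1)) => z pz.
  have [t t0 ht] := sphere_chord phiP gatX p1 pz.
  have z0 : z != 0 by apply: contraTneq pz => ->; rewrite (linear_form0 (phiL p)) ltxx.
  have sp : p - t *: z != p.
    by rewrite -subr_eq0 addrAC subrr add0r oppr_eq0 scaler_eq0 negb_or z0 gt_eqF.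
  have := psi_le (f p - f (p - t *: z)) (T (t *: z)); rewrite psiT //.
  by rewrite opprB addrC subrK phiE TZ !normrZ gtr0_norm // ler_pM2l.
have le_S : forall y, `|y| <= `|E y|.
  apply: (norm_le_of_half_space (psiL (f p)) (etrans (psiE (f p)) fp1)) => z pz.
  have [t t0 ht] := sphere_chord psiP gatY fp1 pz.
  have z0 : z != 0 by apply: contraTneq pz => ->; rewrite (linear_form0 (psiL _)) ltxx.
  have [s s1 fs] := f_onto ht.
  have sp : s != p.
    apply/eqP => sp; have /eqP := fs; rewrite sp eq_sym -subr_eq0 addrAC subrr add0r.
    by rewrite oppr_eq0 scaler_eq0 (negbTE z0) gt_eqF.
  have := phi_le (p - s) (S (t *: z)); rewrite -psiT // TS fs.
  by rewrite opprB addrC subrK psiE SZ !normrZ gtr0_norm // ler_pM2l.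
have normT x : `|T x| = `|x|.
  apply/eqP; rewrite eq_le (le_T x) andbT.
  suff <- : S (T x) = x by rewrite TS; exact: le_S.
  have : `|S (T x) - x| <= `|T (S (T x) - x)| by exact: le_T.
  by rewrite TD TS TN subrr normr0 normr_le0 subr_eq0 => /eqP.
(* [psi (f p - f s)] attains its norm at both vectors, which have equal length, so strict convexity
   identifies them. *)
have chord s : `|s| = 1 -> s != p -> T (p - s) = f p - f s.
  move=> s1 sp; apply/esym; apply: (eq_of_supports mcY (psiP (f p - f s))).
    by rewrite psiT // phiE normT.
  by rewrite normT f_isom.
have Tp : T p = f p.
  have := chord (- p) (etrans (normrN _) p1) opp_p_neq.
  by rewrite f_odd // !twice TZ => /scalerI; apply; rewrite pnatr_eq0.
exists F; split=> [|y|s s1]; first exact: normT.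
- by exists (S y); exact: TS.
- have [->|sp] := eqVneq s p; first exact: Tp.
  change (T s = f s); have := chord s s1 sp.
  by rewrite TD Tp TN => /addrI /oppr_inj.
Qed.

End Directions.

(** A pigeonhole principle as [K] grows: one choice of signs for the tangential coordinates serves
    every [K]. *)
Lemma antitone_cases (Q1 Q2 : R -> Prop) :
  (forall K K', K <= K' -> Q1 K' -> Q1 K) -> (forall K K', K <= K' -> Q2 K' -> Q2 K) ->
  (forall K, Q1 K \/ Q2 K) -> (forall K, Q1 K) \/ (forall K, Q2 K).
Proof.
move=> m1 m2 h; have [|/existsNP[K1 n1]] := pselect (forall K, Q1 K); first by left.
right=> K; case: (h (Num.max K K1)) => [q|].
  by case: n1; apply: m1 q; rewrite le_max lexx orbT.
by apply: m2; rewrite le_max lexx.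
Qed.

Lemma linear_extension : ~ quadratic_at phi p -> exists F : {linear X -> Y},
  [/\ forall x, `|F x| = `|x|, forall y, exists x, F x = y &
    forall s, `|s| = 1 -> F s = f s].
Proof.
move=> nq.
have [e [e1 pe ind sp]] := kernel_basis phiP planarX p1.
have [e' [e1' pe' ind' sp']] := kernel_basis psiP planarY fp1.
pose Q (a a' K : R) := exists x (t t' : R),
  [/\ `|x| = 1, K * `|x - p| ^+ 2 < 1 - phi p x, 0 <= a * t & 0 <= a' * t'] /\
  [/\ x - p = t *: e - (1 - phi p x) *: p,
      f x - f p = t' *: e' - (1 - psi (f p) (f x)) *: f p,
      `| `|t| - `|x - p| | <= 1 - phi p x &
      `| `|t'| - `|x - p| | <= 1 - psi (f p) (f x)].
have antiQ a a' K K' : K <= K' -> Q a a' K' -> Q a a' K.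
  move=> KK' [x [t [t' [[x1 hx ht ht'] h]]]]; exists x, t, t'; split=> //; split=> //.
  by apply: le_lt_trans hx; rewrite ler_wpM2r // exprn_ge0.
have [a [a' [a1 a'1 allQ]]] : exists a a' : R,
    [/\ a * a = 1, a' * a' = 1 & forall K, Q a a' K].
  have cases K : (Q 1 1 K \/ Q 1 (-1) K) \/ (Q (-1) 1 K \/ Q (-1) (-1) K).
    have [x [x1 hx]] := sphere_of_not_quadratic phiP p1 nq K.
    have [t [E ht]] := sphere_coords phiP p1 e1 pe sp x1.
    have [t' [E' ht']] := sphere_coords psiP fp1 e1' pe' sp' (f_sphere x1).
    rewrite f_isom // in ht'.
    by case: (leP 0 t) => t0; case: (leP 0 t') => t'0;
      [left; left|left; right|right; left|right; right]; exists x, t, t';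
      split=> //; split=> //; lra.
  have anti2 a K K' : K <= K' -> Q a 1 K' \/ Q a (-1) K' -> Q a 1 K \/ Q a (-1) K.
    by move=> KK' [q|q]; [left|right]; apply: antiQ KK' q.
  have [h|h] := antitone_cases (anti2 1) (anti2 (-1)) cases.
  - have [q|q] := antitone_cases (antiQ 1 1) (antiQ 1 (-1)) h.
      by exists 1, 1; split=> //; lra.
    by exists 1, (-1); split=> //; lra.
  - have [q|q] := antitone_cases (antiQ (-1) 1) (antiQ (-1) (-1)) h.
      by exists (-1), 1; split=> //; lra.
    by exists (-1), (-1); split=> //; lra.
have unit_norm (r : R) : r * r = 1 -> `|r| = 1.
  move=> rr; have : `|r| * `|r| = 1 by rewrite -normrM rr normr1.
  by have := normr_ge0 r; nra.
have [na na'] := (unit_norm a a1, unit_norm a' a'1).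
have scaled (V : normedModType R) (r : R) (v w : V) :
    r * r = 1 -> independent v w -> independent (r *: v) w.
  move=> rr vw c d; rewrite scalerA => /vw[/eqP cr ->]; split=> //.
  apply/eqP; move: cr; rewrite mulf_eq0 => /orP[//|/eqP r0].
  by move: rr; rewrite r0 mul0r => /eqP; rewrite eq_sym oner_eq0.
have inda := scaled _ _ _ _ a1 ind; have inda' := scaled _ _ _ _ a'1 ind'.
apply: (@linear_extension_directions (a *: e) (a' *: e')) => //.
- by rewrite normrZ na mul1r.
- by rewrite phiZ pe mulr0.
- exact: planarX.2.
- by rewrite normrZ na' mul1r.
move=> eps K eps0 K0.
have [d1 d10 h1] := sphere_flat phiP gatX planarX p1 eps0.
have [d2 d20 h2] := sphere_flat psiP gatY planarY fp1 eps0.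
pose m : R := Num.min (Num.min eps d1) d2.
have m0 : 0 < m by rewrite !lt_min eps0 d10.
have m20 : 0 < m ^+ 2 by rewrite exprn_gt0.
(* A defect never exceeds 2, so one larger than [(2 / m^2) |x - p|^2] forces [|x - p| < m]. *)
have [x [t [t' [[x1 hx ht ht'] [E E' hd hd']]]]] := allQ (Num.max K (2 / m ^+ 2)).
have sg2 : 1 - phi p x <= 2.
  by have := supports_norm x (phiP p); rewrite x1 ler_norml => /andP[]; lra.
have hK : K * `|x - p| ^+ 2 < 1 - phi p x.
  by apply: le_lt_trans hx; rewrite ler_wpM2r ?exprn_ge0 // le_max lexx.
have dm : `|x - p| < m.
  rewrite -ltr_sqr ?nnegrE ?(ltW m0) //.
  have : 2 / m ^+ 2 * `|x - p| ^+ 2 < 2.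
    apply: lt_le_trans sg2; apply: le_lt_trans hx.
    by rewrite ler_wpM2r ?exprn_ge0 // le_max lexx orbT.
  by rewrite mulrAC ltr_pdivrMr // ltr_pM2l.
move: (dm); rewrite !lt_min => /andP[/andP[deps dd1] dd2].
exists x, (a * t), (a' * t'), (1 - phi p x), (1 - psi (f p) (f x)).
have abs (r z : R) : `|r| = 1 -> 0 <= r * z -> `|z| = r * z.
  by move=> r1 rz; rewrite -[RHS]ger0_norm // normrM r1 mul1r.
split; split=> //.
- rewrite normr_gt0 subr_eq0; apply/eqP => xp.
  by move: hK; rewrite xp subrr normr0 expr0n mulr0 phiE p1 subrr ltxx.
- by rewrite scalerA mulrAC a1 mul1r.
- by rewrite scalerA mulrAC a'1 mul1r.
- exact: h1.
- by have := h2 (f x) (f_sphere x1); rewrite f_isom // => /(_ dd2).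
- by rewrite -(abs a t).
- by rewrite -(abs a' t').
Qed.

End Extension.

(** * Properties transferred to the codomain *)

Section UniformConvexity.
Context {R : realType} {Z : normedModType R} (phi : Z -> Z -> R).
Hypothesis phiP : forall u, supports (phi u) u.
Hypotheses (planarZ : planar Z) (mc : midpoint_convex Z).

Lemma planar_ball_compact : exists2 K : set Z, compact K & forall x, `|x| <= 1 -> K x.
Proof.
have [[e1 [e2 ind]] sp] := planarZ; have {}sp := sp _ _ ind.
have [c c0 hc] := coordinates_bound phiP ind.
have cI := @segment_compact R (- c) c.
exists ((fun v : R * R => v.1 *: e1 + v.2 *: e2) @` (`[- c, c] `*` `[- c, c])).
  apply: continuous_compact; last exact: compact_setX.
  apply: continuous_subspaceT => v; apply: cvgD; apply: cvgZr_tmp.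
    exact: cvg_fst.
  exact: cvg_snd.
move=> x x1; have [a [b E]] := sp x; have [ha hb] := hc a b; rewrite -E in ha hb.
have cx : c * `|x| <= c by rewrite ler_piMr // ltW.
exists (a, b) => //=; rewrite !in_itv /= -!ler_norml.
by rewrite (le_trans ha) // (le_trans hb).
Qed.

(** Counterexamples would cluster at a pair in the ball whose sum has norm at least 2; strict
    convexity makes its two members equal, against the gap [eps]. *)
Lemma uniform_convexity (eps : R) : 0 < eps -> exists2 delta : R, 0 < delta &
  forall a b : Z, `|a| = 1 -> `|b| = 1 -> 2 - delta <= `|a + b| -> `|a - b| < eps.
Proof.
move=> eps0; apply: contrapT => no.
have [K cK ballK] := planar_ball_compact.
have /choice[u hu] : forall n : nat, exists v : Z * Z,
    [/\ `|v.1| = 1, `|v.2| = 1, 2 - n.+1%:R^-1 <= `|v.1 + v.2| & eps <= `|v.1 - v.2|].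
  move=> n; apply: contrapT => nov; apply: no; exists n.+1%:R^-1; first by rewrite invr_gt0.
  move=> a b a1 b1 ab; rewrite ltNge; apply/negP => le.
  by apply: nov; exists (a, b); split.
have [|[a b] _ clu] := compact_subsequence (compact_setX cK cK) (u := u).
  by move=> n; have [h1 h2 _ _] := hu n; split; apply: ballK; rewrite ?h1 ?h2.
have close (r : R) : 0 < r -> exists a' b' : Z, [/\ `|a'| = 1, `|b'| = 1,
    `|a - a'| < r, `|b - b'| < r & 2 - r <= `|a' + b'| /\ eps <= `|a' - b'|].
  move=> r0; have [n nr [/= h1 h2]] := clu r (Num.bound r^-1) r0.
  rewrite -ball_normE /= in h1; rewrite -ball_normE /= in h2.
  exists (u n).1, (u n).2; have [k1 k2 k3 k4] := hu n; split=> //; split=> //.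
  apply: le_trans k3; rewrite lerD2l lerN2 invf_ple ?posrE //.
  apply: (le_trans (ltW (archi_boundP _))); first by rewrite invr_ge0 ltW.
  by rewrite ler_nat (leq_trans nr).
have le1 (z : Z) : (forall r : R, 0 < r -> exists2 z', `|z'| = 1 & `|z - z'| < r) -> `|z| <= 1.
  move=> h; apply/ler_addgt0Pr => r r0; have [z' z1 zz] := h r r0.
  by have := lerB_dist z z'; rewrite z1; lra.
have na : `|a| <= 1.
  by apply: le1 => r r0; have [a' [b' [h1 h2 h3 h4 [h5 h6]]]] := close r r0; exists a'.
have nb : `|b| <= 1.
  by apply: le1 => r r0; have [a' [b' [h1 h2 h3 h4 [h5 h6]]]] := close r r0; exists b'.
have ab2 : 2 <= `|a + b|.
  apply/ler_addgt0Pr => r r0; have r40 : 0 < r / 4 by lra.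
  have [a' [b' [h1 h2 h3 h4 [h5 h6]]]] := close _ r40.
  have E : a' + b' = a + b - (a - a' + (b - b')).
    by rewrite [a - a' + _]addrACA -opprD subKr.
  have := ler_normB (a + b) (a - a' + (b - b')); rewrite -E.
  by have := ler_normD (a - a') (b - b'); lra.
have := ler_normD a b => abn.
have eq_ab : a = b by apply: mc; lra.
have [a' [b' [h1 h2 h3 h4 [h5 h6]]]] := close _ (ltac:(lra) : 0 < eps / 2).
have := ler_normD (a' - a) (a - b').
by rewrite -eq_ab in h4; rewrite addrA subrK (distrC a' a); lra.
Qed.

End UniformConvexity.

Lemma subr_shift (V : zmodType) (x y a b : V) : x - y - (x - a - (y - b)) = a - b.
Proof. by rewrite opprB addrA addrA subrK opprB addrC addrA subrK. Qed.

Section Transfer.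
Context {R : realType} {X Y : normedModType R}.
Variables (phi : X -> X -> R) (f : X -> Y).
Hypotheses (phiP : forall u, supports (phi u) u) (gatX : gateaux phi).
Hypotheses (planarX : planar X) (mcX : midpoint_convex X).
Hypothesis f_sphere : forall x, `|x| = 1 -> `|f x| = 1.
Hypothesis f_isom : forall x y, `|x| = 1 -> `|y| = 1 -> `|f x - f y| = `|x - y|.
Hypothesis f_onto : forall y, `|y| = 1 -> exists2 x, `|x| = 1 & f x = y.

Let phiL u : linear_form (phi u). Proof. by have [] := phiP u. Qed.
Let phiE u : phi u u = `|u|. Proof. by have [] := phiP u. Qed.
Let phi_le u x : phi u x <= `|x|. Proof. by have [] := phiP u. Qed.
Let phiD u x y : phi u (x + y) = phi u x + phi u y. Proof. exact: linear_formD. Qed.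
Let phiN u x : phi u (- x) = - phi u x. Proof. exact: linear_formN. Qed.
Let phiZ u (c : R) x : phi u (c *: x) = c * phi u x. Proof. exact: linear_formZ. Qed.

Lemma sphere_inj x y : `|x| = 1 -> `|y| = 1 -> f x = f y -> x = y.
Proof.
move=> x1 y1 fxy; apply/eqP; rewrite -subr_eq0 -normr_eq0 -f_isom //.
by rewrite fxy subrr normr0.
Qed.

(** By strict convexity of X, [- x] is the only point of the sphere at distance 2 from [x]. *)
Lemma sphere_isometry_odd x : `|x| = 1 -> f (- x) = - f x.
Proof.
move=> x1; have nf : `|- f x| = 1 by rewrite normrN f_sphere.
have [y y1 fy] := f_onto nf.
have : `|y + - x| = 2.
  rewrite -f_isom // fy -opprD normrN -mulr2n -scaler_nat normrZ f_sphere //.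
  by rewrite mulr1 ger0_norm.
by move=> /(mcX y1 (etrans (normrN _) x1)) <-.
Qed.

(** Oddness turns the norm of a sum into a distance, which [f] preserves. *)
Lemma midpoint_convex_transfer : midpoint_convex Y.
Proof.
move=> a b a1 b1 ab; have [x x1 fx] := f_onto a1; have [y y1 fy] := f_onto b1.
rewrite -fx -fy; congr f; apply: mcX => //.
rewrite -[y]opprK -f_isom ?normrN // sphere_isometry_odd // fx fy opprK //.
Qed.

Lemma uniform_convexity_transfer (eps : R) : 0 < eps -> exists2 delta : R, 0 < delta &
  forall a b : Y, `|a| = 1 -> `|b| = 1 -> 2 - delta <= `|a - b| -> `|a + b| < eps.
Proof.
move=> eps0; have [delta d0 hd] := uniform_convexity phiP planarX mcX eps0.
exists delta => // a b a1 b1.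
have [x x1 <-] := f_onto a1; have [y y1 <-] := f_onto b1.
rewrite f_isom // => xy; rewrite -[f y]opprK -sphere_isometry_odd //.
rewrite f_isom ?normrN //; apply: hd; rewrite ?normrN //.
Qed.

(* If [Y] had three independent directions [q], [z0], [z1], then [z0] could be
   joined to [- z0] avoiding the line of [q]; pulled back to the sphere of [X],
   an odd function vanishing only at [p] and [- p] would keep its sign. *)
Lemma planar_transfer : planar Y.
Proof.
have [[p0 [p0' ind0]] _] := planarX.
have np0 : 0 < `|p0| by rewrite normr_gt0 (independent_neq0l ind0).
pose p := `|p0|^-1 *: p0.
have p1 : `|p| = 1 by rewrite normrZ gtr0_norm ?invr_gt0 // mulVf // gt_eqF.
clearbody p; clear p0 p0' ind0 np0.
have [e [e1 pe ind sp]] := kernel_basis phiP planarX p1.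
have [A [B [lA lB AB]]] := coordinates ind sp.
have [c c0 hc] := coordinates_bound phiP ind.
have Ac x : `|A x| <= c * `|x| by have [h _] := hc (A x) (B x); rewrite -AB in h.
have A0 x : `|x| = 1 -> A x = 0 -> exists2 r : R, `|r| = 1 & f x = r *: f p.
  move=> x1 Ax; have xE : x = B x *: p by rewrite {1}(AB x) Ax scale0r add0r.
  have nB : `|B x| = 1 by rewrite -x1 {2}xE normrZ p1 mulr1.
  exists (B x) => //; move/eqP: nB; rewrite eqr_norml ler01 andbT => /orP[] /eqP Bx.
    by rewrite {1}xE Bx !scale1r.
  by rewrite {1}xE Bx !scaleN1r sphere_isometry_odd.
(* [g] inverts [f] on the sphere; its value elsewhere is irrelevant and set to 0. *)
have /choice[g hg] : forall y : Y, exists x, `|y| = 1 -> `|x| = 1 /\ f x = y.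
  move=> y; have [y1|y1] := eqVneq `|y| 1; last by exists 0 => /eqP; rewrite (negbTE y1).
  by have [x x1 fx] := f_onto y1; exists x.
pose q := f p; pose z0 := f e.
have q1 : `|q| = 1 by rewrite f_sphere.
have q0 : q != 0 by rewrite -normr_gt0 q1.
have z0q a : z0 != a *: q.
  apply/eqP => z0q; have na : `|a| = 1.
    by have := f_sphere e1; rewrite -/z0 z0q normrZ q1 mulr1.
  move/eqP: na; rewrite eqr_norml ler01 andbT => /orP[] /eqP aE.
    move: z0q; rewrite aE scale1r => /(sphere_inj e1 p1) ep.
    by move: pe; rewrite ep phiE p1 => /eqP; rewrite oner_eq0.
  move: z0q; rewrite aE scaleN1r -sphere_isometry_odd // => /(sphere_inj e1) ep.
  have : phi p (- p) = 0 by rewrite -ep ?pe // normrN.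
  by rewrite phiN phiE p1 => /eqP; rewrite oppr_eq0 oner_eq0.
have indq : independent q z0 by exact: independentP.
apply: (spanning_planar indq) => z1; apply: contrapT => nsp.
(* [h] is the [e]-coordinate of the preimage of the normalized vector; for [y != 0] it vanishes only
   if that preimage is [p] or [- p], that is, on the line of [q]. *)
pose h (y : Y) := A (g (`|y|^-1 *: y)).
have unit (y : Y) : y != 0 -> `| `|y|^-1 *: y| = 1.
  by move=> y0; rewrite normrZ gtr0_norm ?invr_gt0 ?normr_gt0 // mulVf // normr_eq0.
have h_neq0 (y : Y) : (forall a, y != a *: q) -> h y != 0.
  move=> yq; have y0 : y != 0 by have := yq 0; rewrite scale0r.
  have [g1 fg] := hg _ (unit y y0).
  apply/eqP => /(A0 _ g1)[r r1]; rewrite fg => E.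
  have := yq (`|y| * r); rewrite -scalerA -E scalerA divff ?normr_eq0 //.
  by rewrite scale1r eqxx.
have h_odd (y : Y) : y != 0 -> h (- y) = - h y.
  move=> y0; rewrite /h normrN scalerN.
  have [g1 fg] := hg _ (unit y y0).
  have [g1' fg'] := hg _ (etrans (normrN _) (unit y y0)).
  rewrite -linear_formN //; congr A; apply: sphere_inj => //; rewrite ?normrN //.
  by rewrite sphere_isometry_odd // fg fg'.
have h_sign (v w : Y) : (forall t a : R, v + t *: w != a *: q) -> 0 < h v * h (v + w).
  move=> vw; pose u (t : R) := `|v + t *: w|^-1 *: (v + t *: w).
  have vw0 t : v + t *: w != 0 by have := vw t 0; rewrite scale0r.
  have cu : continuous u.
    move=> t; apply: cvgZ; last first.
      by apply: cvgD; [exact: cvg_cst|apply: cvgZr_tmp; exact: cvg_id].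
    apply: cvgV; first by rewrite normr_eq0.
    exact: continuous_norm_line.
  have ch : continuous (fun t : R => h (v + t *: w)).
    move=> t; apply/cvgrPdist_lt => eps eps0.
    have /cvgrPdist_lt/(_ (eps / c) (divr_gt0 eps0 c0)) := cu t.
    apply: filterS => t' ht'; rewrite /h -(linear_formB _ _ lA).
    apply: (le_lt_trans (Ac _)); rewrite mulrC -ltr_pdivlMr //.
    have [g1 fg] := hg _ (unit _ (vw0 t)); have [g1' fg'] := hg _ (unit _ (vw0 t')).
    by rewrite -f_isom // fg fg'; exact: ht'.
  have hn0 t : h (v + t *: w) != 0 by apply: h_neq0.
  rewrite ltNge; apply/negP => le.
  have [|t _ ht] := @IVT R (fun t : R => h (v + t *: w)) 0 1 0 ler01 (continuous_subspaceT ch).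
    rewrite scale0r addr0 scale1r ge_min le_max.
    have n0 := hn0 0; have n1 := hn0 1; rewrite scale0r addr0 scale1r in n0 n1.
    have [hv|hv] := ltP (h v) 0.
      by move: le; rewrite nmulr_rle0 // => ->; rewrite (ltW hv).
    have {}hv : 0 < h v by rewrite lt_neqAle eq_sym n0.
    by move: le; rewrite pmulr_rle0 // => ->; rewrite orbT.
  by have := hn0 t; rewrite ht eqxx.
have z00 : z0 != 0 by have := z0q 0; rewrite scale0r.
(* The path goes from [z0] to [z1] and on to [- z0]; meeting the line of [q] would put [z1] in the
   span of [q] and [z0], or [z0] on that line. *)
have := @h_sign z0 (z1 - z0); have := @h_sign z1 (- z0 - z1).
rewrite (addrC z1) subrK (addrC z0) subrK h_odd // => s1 s2.
have {}s2 : 0 < h z0 * h z1.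
  apply: s2 => t a; apply/eqP => E; have [t0|t0] := eqVneq t 0.
    by move: E; rewrite t0 scale0r addr0 => E; have := z0q a; rewrite E eqxx.
  apply: nsp; exists (t^-1 * a), (t^-1 * (t - 1)).
  apply: (scalerI t0); rewrite scalerDr !scalerA !mulrA !divff // !mul1r -E.
  by rewrite scalerBr scalerBl scale1r (addrC z0) -addrA [z0 + _]addrC !subrK.
have {}s1 : 0 < h z1 * - h z0.
  apply: s1 => t a; apply/eqP => E; have [t1|t1] := eqVneq (1 - t) 0.
    have tE : t = 1 by lra.
    move: E; rewrite tE scale1r (addrC z1) subrK => E.
    by have := z0q (- a); rewrite scaleNr -E opprK eqxx.
  apply: nsp; exists ((1 - t)^-1 * a), ((1 - t)^-1 * t).
  apply: (scalerI t1); rewrite scalerDr !scalerA !mulrA !divff // !mul1r -E.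
  by rewrite scalerBr scalerN scalerBl scale1r -addrA [_ + t *: z0]addrAC addNr add0r.
by move: s1; rewrite mulrN oppr_gt0 mulrC; lra.
Qed.

(** A corner of Y carries two different support functionals. Smoothness of X gives points [x], [x']
    on both sides of [x0], at distance about [t] from it and [2 t] from each other. Their images
    seen from [y0] then have nearly opposite directions by uniform convexity. Support functionals at
    [y0] are nonpositive on both directions, hence both nearly vanish on [w], which is impossible
    for a unit vector of the plane. *)
Lemma gateaux_transfer (psi : Y -> Y -> R) :
  (forall u, supports (psi u) u) -> gateaux psi.
Proof.
move=> psiP u d eps u0 ud eps0; apply: contrapT => no.
have above t : 0 < t -> `|u| + eps * t < `|u + t *: d|.
  by move=> t0; rewrite ltNge; apply/negP => le; apply: no; exists t.
have [ind [g2 g2P g2d]] := corner_support psiP planar_transfer u0 ud eps0 above.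
pose g1 := psi u; have g1P : supports g1 u := psiP u.
have [g1L _ g1le] := g1P; have [g2L _ g2le] := g2P.
have nu : 0 < `|u| by rewrite normr_gt0.
pose y0 := `|u|^-1 *: u.
have y01 : `|y0| = 1 by rewrite normrZ gtr0_norm ?invr_gt0 // mulVf // gt_eqF.
have at_y0 (g : Y -> R) : supports g u -> g y0 = 1.
  by move=> [gL gu _]; rewrite linear_formZ // gu mulVf // gt_eqF.
have [x0 x01 fx0] := f_onto y01.
have [e [e1 pe _ _]] := kernel_basis phiP planarX x01.
have x00 : x0 != 0 by rewrite -normr_gt0 x01.
have [A [B [lA lB AB]]] := coordinates ind (planar_transfer.2 _ _ ind).
(* In coordinates [|A w| |u| <= r] and [|B w| eps <= r], so the unit vector [w] would have norm at
   most [r (1 + |d| / eps) = 1/4]. *)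
pose r : R := 1 / (4 * (`|d| / eps + 1)).
have den0 : 0 < `|d| / eps + 1 by rewrite ltr_wpDl // divr_ge0 // ltW.
have r0 : 0 < r by rewrite divr_gt0 // mulr_gt0.
have [delta delta0 hdelta] := uniform_convexity_transfer r0.
(* The estimate of [|w - w'|] loses [2 eta] in [far] and [2 eta] in the two normalizations, at most
   [delta] in all; [eta < 1] keeps [h] and [h'] nonzero. *)
pose eta : R := Num.min (1 / 4) (delta / 4).
have eta0 : 0 < eta by rewrite lt_min; lra.
have eta1 : eta <= 1 / 4 by rewrite ge_min lexx.
have eta2 : eta <= delta / 4 by rewrite ge_min lexx orbT.
have [t1 t10 ht1] := continuous_support phiP gatX e x00 eta0.
pose t := t1 / 2; have t0 : 0 < t by rewrite divr_gt0.
have near (s : R) : `|s| = t -> exists x, [/\ `|x| = 1,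
    `|x - (x0 + s *: e)| <= eta * t & `| `|x - x0| - t| <= eta * t].
  move=> st; pose w := x0 + s *: e.
  have wd : `|w - x0| < t1.
    by rewrite /w addrAC subrr add0r normrZ e1 mulr1 st /t; lra.
  have := ht1 w wd; rewrite pe subr0 => hw.
  have w1 : 1 <= `|w| by have := phi_le x0 w; rewrite phiD phiZ pe mulr0 addr0 phiE x01.
  have w2 : `|w| <= 1 + eta * t.
    have : `|w| = phi w x0 + s * phi w e by rewrite -phiZ -phiD phiE.
    have := phi_le w x0; have := ler_norm (s * phi w e).
    have : `|s| * `|phi w e| <= eta * t by rewrite st mulrC ler_wpM2r // ltW.
    by rewrite normrM x01; lra.
  have w0 : 0 < `|w| by lra.
  pose x := `|w|^-1 *: w.
  have x1 : `|x| = 1 by rewrite normrZ gtr0_norm ?invr_gt0 // mulVf // gt_eqF.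
  have xw : x - w = (1 - `|w|) *: x.
    by rewrite scalerBl scale1r /x scalerA divff ?gt_eqF // scale1r.
  exists x; have dx : `|x - w| <= eta * t by rewrite xw normrZ x1 mulr1 ler0_norm; lra.
  split=> //; have -> : t = `|s *: e| by rewrite normrZ e1 mulr1.
  apply: (le_trans (ler_dist_dist _ _)); rewrite normrZ e1 mulr1 st.
  by rewrite -addrA -opprD.
have [x [x1 hx nx]] := near t (gtr0_norm t0).
have [x' [x1' hx' nx']] := near (- t) (etrans (normrN _) (gtr0_norm t0)).
have far : (2 - 2 * eta) * t <= `|x - x'|.
  have xx : x - x' - (x - (x0 + t *: e) - (x' - (x0 + - t *: e))) = (2 * t) *: e.
    rewrite subr_shift opprD addrACA subrr add0r scaleNr opprK -scalerDl.
    by congr (_ *: _); lra.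
  have := ler_normB (x - x') (x - (x0 + t *: e) - (x' - (x0 + - t *: e))).
  have := ler_normB (x - (x0 + t *: e)) (x' - (x0 + - t *: e)).
  by rewrite xx normrZ e1 mulr1 gtr0_norm ?mulr_gt0 //; lra.
pose h := f x - y0; pose h' := f x' - y0.
have nh : `|h| = `|x - x0| by rewrite /h -fx0 f_isom.
have nh' : `|h'| = `|x' - x0| by rewrite /h' -fx0 f_isom.
have scaled (v : Y) : `| `|v| - t| <= eta * t ->
    `| `|v|^-1 *: v| = 1 /\ `| `|v|^-1 *: v - t^-1 *: v| <= eta.
  move=> vt; have v0 : 0 < `|v| by move: vt; rewrite ler_norml => /andP[]; nra.
  split; first by rewrite normrZ gtr0_norm ?invr_gt0 // mulVf // gt_eqF.
  rewrite -scalerBl normrZ -[X in _ * X](gtr0_norm v0) -normrM mulrBl mulVf ?gt_eqF //.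
  have -> : 1 - t^-1 * `|v| = - (`|v| - t) / t by field; rewrite gt_eqF.
  by rewrite normrM normrN normfV (gtr0_norm t0) ler_pdivrMr.
have [w1 wh] := scaled h (ltac:(by rewrite nh)).
have [w1' wh'] := scaled h' (ltac:(by rewrite nh')).
set w := `|h|^-1 *: h in w1 wh; set w' := `|h'|^-1 *: h' in w1' wh'.
have : `|w + w'| < r.
  apply: hdelta => //.
  have hh : 2 - 2 * eta <= `|t^-1 *: h - t^-1 *: h'|.
    rewrite -scalerBr normrZ gtr0_norm ?invr_gt0 // ler_pdivlMl // (mulrC t).
    have -> : h - h' = f x - f x' by rewrite /h /h' opprB addrA subrK.
    by rewrite f_isom.
  have E : t^-1 *: h - t^-1 *: h' = (w - w') - ((w - t^-1 *: h) - (w' - t^-1 *: h')).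
    by rewrite subr_shift.
  rewrite E in hh.
  have := ler_normB (w - w') ((w - t^-1 *: h) - (w' - t^-1 *: h')).
  have := ler_normB (w - t^-1 *: h) (w' - t^-1 *: h').
  by lra.
move=> ww.
have neg (g : Y -> R) : supports g u -> g w <= 0 /\ - r <= g w.
  move=> gP; have [gL _ gle] := gP.
  have half (z : X) : `|z| = 1 -> g (`|f z - y0|^-1 *: (f z - y0)) <= 0.
    move=> z1; rewrite (linear_formZ _ _ gL) (linear_formB _ _ gL) (at_y0 _ gP).
    by rewrite mulr_ge0_le0 ?invr_ge0 //; have := gle (f z); rewrite f_sphere //; lra.
  split; first exact: half.
  have := half x' x1'; rewrite -/h' -/w' => gw'.
  have := supports_norm (w + w') gP; rewrite linear_formD // ler_norml => /andP[+ _].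
  by lra.
have [a1 a2] := neg g1 g1P; have [b1 b2] := neg g2 g2P.
have g1w : g1 w = A w * `|u|.
  rewrite {1}(AB w) (linear_formD _ _ g1L) !(linear_formZ _ _ g1L).
  by have [_ -> _] := g1P; rewrite /g1 ud mulr0 addr0.
have g2w : g2 w = A w * `|u| + B w * eps.
  rewrite {1}(AB w) (linear_formD _ _ g2L) !(linear_formZ _ _ g2L) g2d.
  by have [_ -> _] := g2P.
have nA : `|A w| * `|u| <= r.
  by rewrite -[X in _ * X]gtr0_norm // -normrM -g1w ler_norml; lra.
have nB : `|B w| * eps <= r.
  by rewrite -[X in _ * X]gtr0_norm // -normrM ler_norml; lra.
have nB' : `|B w| * `|d| <= r * (`|d| / eps).
  rewrite mulrA ler_pdivlMr // mulrAC; apply: ler_wpM2r => //.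
have : 1 <= `|A w| * `|u| + `|B w| * `|d|.
  by rewrite -w1 {1}(AB w) (le_trans (ler_normD _ _)) // !normrZ.
have : r * (`|d| / eps + 1) = 1 / 4.
  by rewrite /r; move: den0; set k := _ + 1 => k0; field; rewrite gt_eqF.
by lra.
Qed.

End Transfer.

(** * Absolute continuity of calm monotone functions *)

Section CalmMonotone.
Context {R : realType}.
Implicit Types (F : R -> R) (A B : R).

(** [C] and [eta] depend on [t] without any local bound, so this is weaker than local Lipschitz
    continuity; monotonicity has to make up for it. *)
Definition calm F := forall t, exists C eta : R, [/\ 0 <= C, 0 < eta &
  forall u, `|u - t| < eta -> `|F u - F t| <= C * `|u - t|].

Lemma calm_continuous F : calm F -> continuous F.
Proof.
move=> cF t; apply/cvgrPdist_lt => eps eps0.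
have [C [eta [C0 eta0 h]]] := cF t.
apply/nbhs_ballP; exists (Num.min eta (eps / (C + 1))) => /=.
  by rewrite lt_min eta0 divr_gt0 //; lra.
move=> u; rewrite /ball /= distrC lt_min => /andP[ut]; rewrite ltr_pdivlMr; last by lra.
move=> ute; rewrite distrC; apply: le_lt_trans (h u ut) _.
by apply: le_lt_trans ute; rewrite mulrC ler_wpM2l //; lra.
Qed.

Lemma lebesgue_stieltjes_measure_itv (G : cumulative R R) A B : A <= B ->
  lebesgue_stieltjes_measure G `]A, B]%classic = (G B - G A)%:E.
Proof.
move=> AB; apply: (etrans (@measurable_mu_extE _ R _ (wlength G) _ (is_ocitv A B))).
exact: wlength_itv_bnd.
Qed.

(* The points where [F] is [k.+1]-Lipschitz at scale [1 / k.+1] exhaust the line, so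
   their complements in [`[A, B]] have small Stieltjes measure; an interval of
   length below [1 / k.+1] that meets them contributes at most [k.+1] times its length. *)
Lemma calm_abs_continuous F A B : {homo F : x y / x <= y} -> calm F ->
  forall eps : R, 0 < eps -> exists2 delta : R, 0 < delta &
    forall (n : nat) (a b : nat -> R),
      (forall i, (i < n)%N -> [/\ A <= a i, b i <= B & a i < b i]) ->
      (forall i, (i.+1 < n)%N -> b i < a i.+1) ->
      \sum_(i < n) (b i - a i) < delta ->
      \sum_(i < n) (F (b i) - F (a i)) < eps.
Proof.
move=> ndF cF eps eps0; have contF := calm_continuous cF.
pose G : cumulative R R :=
  HB.pack F (isCumulative.Build R _ R F ndF (right_continuousW contF)).
pose mu := lebesgue_stieltjes_measure G.
have mu_itv a b : a <= b -> mu `]a, b]%classic = (F b - F a)%:E.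
  exact: (@lebesgue_stieltjes_measure_itv G).
pose E (k : nat) : set R :=
  [set t | forall u, `|u - t| < k.+1%:R^-1 -> `|F u - F t| <= k.+1%:R * `|u - t|].
have cE k : closed (E k).
  have -> : E k = \bigcap_(u in setT) ([set t | k.+1%:R^-1 <= `|u - t|] `|`
      [set t | `|F u - F t| - k.+1%:R * `|u - t| <= 0]).
    apply/seteqP; split=> t Et.
      move=> u _; have [ut|ut] := ltP `|u - t| k.+1%:R^-1; last by left.
      by right=> /=; rewrite subr_le0; exact: Et.
    by move=> u ut; case: (Et u I) => /=; [rewrite leNgt ut|rewrite subr_le0].
  have cd (u : R) : continuous (fun t : R => `|u - t|).
    by move=> t; apply: cvg_norm; apply: cvgB; [exact: cvg_cst|exact: cvg_id].
  apply: closed_bigI => u _; apply: closedU.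
    by apply: (@closed_comp _ _ (fun t : R => `|u - t|) [set y | _ <= y]) => [t _|];
      [exact: cd|exact: closed_ge].
  apply: (@closed_comp _ _ (fun t : R => `|F u - F t| - k.+1%:R * `|u - t|)
    [set y | y <= 0]) => [t _|]; last exact: closed_le.
  apply: cvgB; last by apply: cvgMr; exact: cd.
  by apply: cvg_norm; apply: cvgB; [exact: cvg_cst|exact: contF].
pose D k := `]A, B]%classic `\` E k.
have mE k : measurable (E k) by apply: measurable_realfun.closed_measurable.
have mD k : measurable (D k) by apply: measurableD.
have D0 : \bigcap_k D k = set0.
  apply/seteqP; split=> // t Dt.
  have [C [eta [C0 eta0 h]]] := cF t.
  have [k [kC keta]] : exists k : nat, C <= k.+1%:R /\ k.+1%:R^-1 <= eta.
    exists (maxn (Num.bound C) (Num.bound eta^-1)); split.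
      apply: (le_trans (ltW (archi_boundP C0))); rewrite ler_nat.
      by apply: (leq_trans (leq_maxl _ _) (leqnSn _)).
    rewrite invf_ple ?posrE //; apply: (le_trans (ltW (archi_boundP _))).
      by rewrite invr_ge0 ltW.
    by rewrite ler_nat; apply: (leq_trans (leq_maxr _ _) (leqnSn _)).
  have [_] := Dt k I; apply=> u ut; apply: (le_trans (h u _)).
    exact: lt_le_trans keta.
  by rewrite ler_wpM2r.
have decD : nonincreasing_seq D.
  move=> i j ij; apply/subsetPset; apply: setDS => t Et u ut.
  have ij' : i.+1%:R <= j.+1%:R :> R by rewrite ler_nat.
  apply: (le_trans (Et u _)); last by rewrite ler_wpM2r.
  by apply: (lt_le_trans ut); rewrite lef_pV2 ?posrE.
(* The maximum covers [B < A], where the interval is empty. *)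
have finD : (mu (D 0%N) < +oo)%E.
  apply: (@le_lt_trans _ _ (mu `]A, Num.max A B]%classic)).
    apply: le_measure; rewrite ?inE; [exact: mD|exact: measurable_itv|].
    move=> t [/= + _].
    by rewrite !in_itv /= le_max => /andP[-> ->]; rewrite orbT.
  by rewrite mu_itv ?ltry // le_max lexx.
have [k Dk] : exists k, (mu (D k) < (eps / 2)%:E)%E.
  have mcap : measurable (\bigcap_k D k) by rewrite D0.
  have := nonincreasing_cvg_mu finD mD mcap decD.
  rewrite D0 measure0 => /fine_cvgP[[N1 _ fin] /cvgrPdist_lt/(_ (eps / 2) (ltac:(lra)))].
  move=> [N2 _ small]; exists (maxn N1 N2).
  have f1 := fin _ (leq_maxl N1 N2 : (N1 <= maxn N1 N2)%N).
  have := small _ (leq_maxr N1 N2 : (N2 <= maxn N1 N2)%N).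
  rewrite /= sub0r normrN -lte_fin => /(le_lt_trans _); apply.
  by rewrite -[leLHS](fineK f1) lee_fin ler_norm.
have K0 : 0 < k.+1%:R :> R by [].
(* The first bound keeps each interval below the scale of [E k]; the second limits the Lipschitz
   contributions to [eps / 2]. *)
exists (Num.min k.+1%:R^-1 (eps / (2 * k.+1%:R))).
  by rewrite lt_min invr_gt0 K0 divr_gt0 // mulr_gt0.
move=> n a b hab hba; rewrite lt_min => /andP[sum1 sum2].
have blt i j : (i < j)%N -> (j < n)%N -> b i < a j.
  elim: j => // j IH; rewrite ltnS leq_eqVlt => /orP[/eqP <-|ij] jn; first exact: hba.
  have [_ _ aj] := hab j (ltnW jn).
  by apply: (lt_trans (IH ij (ltnW jn))); apply: (lt_trans aj); exact: hba.
have len i : (i < n)%N -> b i - a i < k.+1%:R^-1.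
  move=> ni; apply: le_lt_trans sum1; rewrite (bigD1 (Ordinal ni)) //= lerDl.
  by apply: sumr_ge0 => j _; have [_ _ h] := hab j (ltn_ord j); rewrite subr_ge0 ltW.
pose I' (i : 'I_n) := `]a i, b i]%classic `\` E k.
have mI' i : measurable (I' i) by apply: measurableD.
have termwise (i : 'I_n) :
    ((F (b i) - F (a i))%:E <= (k.+1%:R * (b i - a i))%:E + mu (I' i))%E.
  have [Aa Bb ab] := hab i (ltn_ord i); have li := len i (ltn_ord i).
  have [[t [/= tab Et]]|no] := pselect (exists t, `]a i, b i]%classic t /\ E k t).
    apply: (@le_trans _ _ (k.+1%:R * (b i - a i))%:E); last by rewrite leeDl.
    rewrite lee_fin; move: tab; rewrite in_itv /= => /andP[ta tb].
    have h1 := Et (b i); have h2 := Et (a i).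
    rewrite ger0_norm ?subr_ge0 // in h1; rewrite ler0_norm ?subr_le0 ?(ltW ta) // in h2.
    have {}h1 := h1 (le_lt_trans (ltac:(lra) : b i - t <= b i - a i) li).
    have {}h2 := h2 (le_lt_trans (ltac:(lra) : - (a i - t) <= b i - a i) li).
    have := ler_norm (F (b i) - F t); have := ler_norm (- (F (a i) - F t)).
    by rewrite normrN; lra.
  have -> : I' i = `]a i, b i]%classic.
    apply/seteqP; split=> t; first by case.
    by move=> tab; split=> // Et; apply: no; exists t.
  by rewrite mu_itv ?(ltW ab) // -EFinD lee_fin lerDr mulr_ge0 // subr_ge0 ltW.
have disj : trivIset setT I'.
  apply/trivIsetP => i j _ _; wlog ij : i j / (i < j)%N.
    move=> H; rewrite neq_ltn => /orP[ij|ji]; first by apply: H => //; rewrite neq_ltn ij.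
    by rewrite setIC; apply: H => //; rewrite neq_ltn ji.
  move=> _; apply/seteqP; split=> // t [[/= + _] [/= + _]].
  rewrite !in_itv /= => /andP[_ tb] /andP[ta _].
  by have := blt i j ij (ltn_ord j); lra.
have union : (\sum_(i < n) mu (I' i) <= mu (D k))%E.
  rewrite -(measure_bigsetU_ord mu xpredT mI' disj); apply: le_measure; rewrite ?inE.
  - by apply: bigsetU_measurable => i _; exact: mI'.
  - exact: mD.
  apply: (big_ind (fun S => S `<=` D k)) => [//|S T hS hT t [/hS|/hT]|i _] //.
  move=> t [/= tab Et]; split=> //=.
  have [Aa Bb _] := hab i (ltn_ord i).
  by move: tab; rewrite !in_itv /= => /andP[ta tb]; rewrite (le_lt_trans Aa) //= (le_trans tb).
rewrite -lte_fin -sumEFin.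
apply: (@le_lt_trans _ _ (\sum_(i < n) ((k.+1%:R * (b i - a i))%:E + mu (I' i)))%E).
  by apply: lee_sum => i _; exact: termwise.
rewrite big_split /= sumEFin -mulr_sumr.
have -> : eps = eps / 2 + eps / 2 by lra.
rewrite EFinD; apply: lteD; last exact: (le_lt_trans union).
by move: sum2; rewrite lte_fin ltr_pdivlMr ?mulr_gt0 //; lra.
Qed.
End CalmMonotone.

(** * Derivatives and primitives *)

Section RealCalculus.
Context {R : realType}.

Lemma is_derive_norm_leP (V : normedModType R) (f : R -> V) (t : R) (l : V) :
  is_derive t (1 : R) f l <-> forall eps : R, 0 < eps -> exists2 delta : R, 0 < delta &
    forall s, `|s - t| < delta -> `|f s - f t - (s - t) *: l| <= eps * `|s - t|.
Proof.
split=> [[df dl] eps eps0|h].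
  have /cvgrPdist_lt/(_ eps eps0)/nbhs_ballP[delta /= delta0 hd] :
      h^-1 *: (f (h *: 1 + t) - f t) @[h --> 0^'] --> l.
    by rewrite -dl; exact: df.
  exists delta => // s st; have [->|nst] := eqVneq s t.
    by rewrite !subrr scale0r normr0 subrr normr0 mulr0.
  have h0 : s - t != 0 by rewrite subr_eq0.
  have := hd (s - t); rewrite /ball /= sub0r normrN => /(_ st h0).
  rewrite [_%:A]mulr1 subrK => /ltW.
  have -> : f s - f t - (s - t) *: l = (s - t) *: ((s - t)^-1 *: (f s - f t) - l).
    by rewrite scalerBr scalerA divff // scale1r.
  by rewrite normrZ distrC mulrC ler_pM2r ?normr_gt0.
have cv : h^-1 *: (f (h *: 1 + t) - f t) @[h --> (0 : R)^'] --> l.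
  apply/cvgrPdist_le => eps eps0; have [delta delta0 hd] := h eps eps0.
  apply/nbhs_ballP; exists delta => //= k; rewrite /ball /= sub0r normrN => kd k0.
  have := hd (k + t); rewrite addrK => /(_ kd).
  rewrite [_%:A]mulr1.
  have -> : f (k + t) - f t - k *: l = k *: (k^-1 *: (f (k + t) - f t) - l).
    by rewrite scalerBr scalerA divff // scale1r.
  by rewrite normrZ distrC mulrC ler_pM2r ?normr_gt0.
by apply: DeriveDef; [apply/cvg_ex; exists l|exact: (cvg_lim _ cv)].
Qed.

Lemma is_derive_vector (V : normedModType R) (a b : R -> R) (da db t : R) (e1 e2 : V) :
  is_derive t 1 a da -> is_derive t 1 b db ->
  is_derive t (1 : R) (fun s => a s *: e1 + b s *: e2) (da *: e1 + db *: e2).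
Proof.
move=> /is_derive_norm_leP ha /is_derive_norm_leP hb; apply/is_derive_norm_leP => eps eps0.
have M0 : 0 < `|e1| + `|e2| + 1 by rewrite ltr_wpDl // addr_ge0.
pose M := `|e1| + `|e2| + 1.
have [d1 d10 h1] := ha (eps / M) (divr_gt0 eps0 M0).
have [d2 d20 h2] := hb (eps / M) (divr_gt0 eps0 M0).
exists (Num.min d1 d2) => [|s]; first by rewrite lt_min d10.
rewrite lt_min => /andP[/h1 {}h1 /h2 {}h2].
have -> : a s *: e1 + b s *: e2 - (a t *: e1 + b t *: e2) - (s - t) *: (da *: e1 + db *: e2) =
    (a s - a t - (s - t) * da) *: e1 + (b s - b t - (s - t) * db) *: e2.
  have regroup (x y z x' y' z' : V) : x + x' - (y + y') - (z + z') = (x - y - z) + (x' - y' - z').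
    by rewrite !opprD [x + x' + _]addrACA [LHS]addrACA.
  by rewrite [(s - t) *: _]scalerDr !scalerA regroup !scalerBl.
apply: (le_trans (ler_normD _ _)); rewrite !normrZ.
apply: (@le_trans _ _ (eps / M * `|s - t| * `|e1| + eps / M * `|s - t| * `|e2|)).
  by rewrite lerD // ler_wpM2r.
have ME : eps / M * M = eps by rewrite divfK // gt_eqF.
have -> : eps * `|s - t| = eps / M * `|s - t| * M by rewrite mulrAC ME.
by rewrite -mulrDr ler_wpM2l ?lerDl // mulr_ge0 // divr_ge0 ?ltW.
Qed.

Lemma is_derive_second_order (f g : R -> R) (C delta t l : R) : 0 <= C -> 0 < delta ->
  (forall s, `|s - t| < delta -> `|f s - g s| <= C * `|s - t| ^+ 2) ->
  is_derive t 1 g l -> is_derive t 1 f l.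
Proof.
move=> C0 delta0 fg /is_derive_norm_leP hg; apply/is_derive_norm_leP => eps eps0.
have e20 : 0 < eps / 2 by lra.
have [d d0 hd] := hg (eps / 2) e20.
pose r := eps / (2 * (C + 1)).
have C1 : 0 < 2 * (C + 1) by lra.
have r0 : 0 < r by rewrite divr_gt0.
exists (Num.min (Num.min d delta) r) => [|s]; first by rewrite !lt_min d0 delta0.
rewrite !lt_min => /andP[/andP[/hd {}hd sd] sr].
have ft : f t = g t.
  have := fg t; rewrite subrr normr0 expr0n mulr0 => /(_ delta0).
  by rewrite normr_le0 subr_eq0 => /eqP.
have := fg s sd; rewrite ltr_pdivlMr // in sr.
have -> : f s - f t - (s - t) *: l = (f s - g s) + (g s - g t - (s - t) *: l).
  by rewrite ft; ring.
move=> h; apply: (le_trans (ler_normD _ _)).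
have : C * `|s - t| ^+ 2 <= eps / 2 * `|s - t|.
  by rewrite expr2 mulrA ler_wpM2r //; have := normr_ge0 (s - t); lra.
by lra.
Qed.

Lemma continuous_primitive (rho : R -> R) : continuous rho ->
  exists l : R -> R, forall t : R, is_derive t 1 l (rho t).
Proof.
move=> crho; pose mu := @lebesgue_measure R.
have int a b : mu.-integrable `[a, b] (EFin \o rho).
  by apply: continuous_compact_integrable; [exact: segment_compact|exact: continuous_subspaceT].
pose G (m x : R) := (\int[mu]_(s in `[- m, x]) rho s - \int[mu]_(s in `[- m, 0]) rho s)%R.
have GE (m n x : R) : 0 < n -> n <= m -> - n < x ->
    G m x = (\int[mu]_(s in `](- n), x]) rho s - \int[mu]_(s in `](- n), 0]) rho s)%R.
  move=> n0 nm nx; rewrite -!(@Rintegral_itvB _ rho (BLeft (- m))) ?bnd_simp //; try lra.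
  by rewrite /G; ring.
(* The base point moves with [x] so as to stay to the left of both [x] and 0; subtracting the
   integral up to 0 makes the value independent of it, so near [t] the fixed base [- M] can be
   used. *)
pose l (x : R) := G (`|x| + 1) x; exists l => t.
have bound (x : R) : - (`|x| + 1) < x by have := lerNnormlW (lexx `|x|); lra.
pose M := `|t| + 2.
have near_l : \forall x \near t, G M x = l x.
  apply/nbhs_ballP; exists 1 => //= x; rewrite /ball /= => tx.
  have x1 : `|x| + 1 <= M by have := lerB_dist x t; rewrite /M distrC; lra.
  have x0 : 0 < `|x| + 1 by rewrite ltr_wpDl.
  by rewrite /l (GE M (`|x| + 1)) // (GE (`|x| + 1) (`|x| + 1)).
apply: (near_eq_is_derive near_l).
have [||dG GE'] := @continuous_FTC1_closed _ rho (- M) t (t + 1) _ (int _ _) _ (crho t).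
- by rewrite ltrDl.
- by have := bound t; rewrite /M; lra.
rewrite -[rho t]subr0; apply: is_deriveB.
by apply: DeriveDef => //; rewrite -derive1E.
Qed.

Lemma derive_lower_bound (l rho : R -> R) (c : R) : (forall t : R, is_derive t 1 l (rho t)) ->
  (forall t, c <= rho t) -> forall s t, s <= t -> c * (t - s) <= l t - l s.
Proof.
move=> dl crho s t st.
have [|x _ ->] := @MVT_segment R l rho s t st (fun x _ => dl x).
  apply: continuous_subspaceT => x; apply: differentiable_continuous.
  by apply/derivable1_diffP; have [] := dl x.
by rewrite ler_wpM2r // subr_ge0.
Qed.

(** A speed bounded below makes [l] a bijection with an inverse of Lipschitz constant [1 / c]. For
    the speed of the polar curve, [k] is the angle as a function of arc length. *)
Lemma derive_inverse (l rho : R -> R) (c : R) : 0 < c ->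
  (forall t : R, is_derive t 1 l (rho t)) -> (forall t, c <= rho t) ->
  exists k : R -> R, [/\ forall s : R, is_derive s 1 k (rho (k s))^-1,
    {homo k : s t / s < t} & forall s t, s <= t -> k t - k s <= (t - s) / c].
Proof.
move=> c0 dl crho; have low := derive_lower_bound dl crho.
have cl : continuous l.
  by move=> x; apply: differentiable_continuous; apply/derivable1_diffP; have [] := dl x.
have /choice[k lk] : forall y, exists x, l x = y.
  move=> y; pose m := (`|y| + `|l 0|) / c.
  have m0 : 0 <= m by rewrite divr_ge0 ?addr_ge0 // ltW.
  have mE : c * m = `|y| + `|l 0| by rewrite mulrC divfK // gt_eqF.
  have h1 := low 0 m m0; have h2 := low (- m) 0 (ltac:(lra)).
  have y1 := ler_norm y; have y2 := lerNnormlW (lexx `|y|).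
  have l1 := ler_norm (l 0); have l2 := lerNnormlW (lexx `|l 0|).
  have [|x _ <-] := @IVT R l (- m) m y (ltac:(lra)) (continuous_subspaceT cl); last by exists x.
  rewrite ge_min le_max; apply/andP; split; apply/orP; [left|right]; lra.
have linj s t : l s = l t -> s = t.
  have aux a b : a <= b -> l a = l b -> a = b.
    move=> ab lab; have := low a b ab; rewrite lab subrr => h.
    by apply/eqP; rewrite eq_le ab; move: h; rewrite pmulr_rle0 // subr_le0.
  by move=> lst; have [st|/ltW ts] := leP s t; [exact: aux|apply/esym/aux].
have kl : cancel l k by move=> x; apply: linj; rewrite lk.
have lip s t : s <= t -> k s <= k t.
  move=> st; rewrite leNgt; apply/negP => kts.
  have := low _ _ (ltW kts); rewrite !lk.
  have : 0 < c * (k s - k t) by rewrite mulr_gt0 // subr_gt0.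
  lra.
exists k; split.
- move=> s; rewrite -{1}[s]lk; apply: is_derive_inverse.
  + by apply: filterE => x; rewrite kl.
  + by apply: filterE => x; exact: cl.
  + by rewrite gt_eqF // (lt_le_trans c0).
- move=> s t st; rewrite lt_neqAle (lip _ _ (ltW st)) andbT.
  by apply: contraTneq st => kst; rewrite -[s]lk -[t]lk kst ltxx.
- move=> s t st; rewrite ler_pdivlMr // mulrC.
  by have := low _ _ (lip _ _ st); rewrite !lk.
Qed.

End RealCalculus.

(** * Arc-length parametrization *)

Section Trigonometry.
Context {R : realType}.

Lemma lipschitz_of_derive (f df : R -> R) : (forall t : R, is_derive t 1 f (df t)) ->
  (forall t, `|df t| <= 1) -> forall s t, `|f s - f t| <= `|s - t|.
Proof.
move=> hf df1 s t; wlog st : s t / t <= s.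
  by move=> H; have [/H//|/ltW/H] := leP t s; rewrite distrC (distrC s).
have [|x _ ->] := @MVT_segment R f df t s st (fun x _ => hf x).
  apply: continuous_subspaceT => x; apply: differentiable_continuous.
  by apply/derivable1_diffP; have [] := hf x.
by rewrite normrM ler_piMl.
Qed.

Lemma cos_lipschitz (s t : R) : `|cos s - cos t| <= `|s - t|.
Proof.
apply: (lipschitz_of_derive (df := fun t => - sin t)) => // x.
by rewrite normrN ler_norml sin_geN1 sin_le1.
Qed.

Lemma sin_lipschitz (s t : R) : `|sin s - sin t| <= `|s - t|.
Proof.
apply: (lipschitz_of_derive (df := fun t => cos t)) => // x.
by rewrite ler_norml cos_geN1 cos_le1.
Qed.

(** Serves to extend a function that is monotone on a window to one monotone on the whole line. *)
Definition clamp (a b x : R) := Num.max a (Num.min b x).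

Lemma clamp_id a b x : a <= x <= b -> clamp a b x = x.
Proof. by move=> /andP[ax xb]; rewrite /clamp (min_idPr xb) (max_idPr ax). Qed.

Lemma clamp_in a b x : a <= b -> a <= clamp a b x <= b.
Proof. by move=> ab; rewrite /clamp le_max lexx ge_max ab ge_min lexx. Qed.

Lemma clamp_mono a b x y : x <= y -> 0 <= clamp a b y - clamp a b x <= y - x.
Proof.
move=> xy; rewrite /clamp; case: (leP b x) => bx; case: (leP b y) => yb;
  case: (leP a _) => h1; try (case: (leP a _) => h2); lra.
Qed.

Lemma clamp_lipschitz a b x y : `|clamp a b x - clamp a b y| <= `|x - y|.
Proof.
wlog xy : x y / y <= x.
  by move=> H; have [/H//|/ltW/H] := leP y x; rewrite distrC (distrC x).
by have /andP[h1 h2] := clamp_mono a b xy; rewrite !ger0_norm ?subr_ge0 //; lra.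
Qed.

End Trigonometry.

(** * The sphere in polar coordinates when every point is quadratic *)

Section PolarCurve.
Context {R : realType} {Z : normedModType R} (phi : Z -> Z -> R).
Hypothesis phiP : forall u, supports (phi u) u.
Hypothesis quad : forall v : Z, v != 0 -> quadratic_at phi v.
Variables e1 e2 : Z.
Hypothesis ind : independent e1 e2.

Let phiL u : linear_form (phi u). Proof. by have [] := phiP u. Qed.
Let phiE u : phi u u = `|u|. Proof. by have [] := phiP u. Qed.
Let phi_le u x : phi u x <= `|x|. Proof. by have [] := phiP u. Qed.
Let phiD u x y : phi u (x + y) = phi u x + phi u y. Proof. exact: linear_formD. Qed.
Let phiB u x y : phi u (x - y) = phi u x - phi u y. Proof. exact: linear_formB. Qed.
Let phiZ u (c : R) x : phi u (c *: x) = c * phi u x. Proof. exact: linear_formZ. Qed.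

Definition ray (t : R) : Z := cos t *: e1 + sin t *: e2.
Definition ray' (t : R) : Z := - sin t *: e1 + cos t *: e2.
(* the gradient of the norm at [ray t], turned by a right angle: tangent to the sphere *)
Definition tangent (t : R) : Z := - phi (ray t) e2 *: e1 + phi (ray t) e1 *: e2.

Let L := `|e1| + `|e2|.
Let L0 : 0 < L. Proof. by rewrite ltr_pwDl // normr_gt0 (independent_neq0l ind). Qed.

Lemma ray_neq0 t : ray t != 0.
Proof.
apply/eqP => /ind[c0 s0]; have := cos2Dsin2 t; rewrite c0 s0 expr0n addr0 => /esym/eqP.
by rewrite oner_eq0.
Qed.

Lemma ray_lipschitz s t : `|ray s - ray t| <= L * `|s - t|.
Proof.
rewrite /ray opprD addrACA -!scalerBl (le_trans (ler_normD _ _)) // !normrZ.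
have h1 := ler_wpM2r (normr_ge0 e1) (cos_lipschitz s t).
have h2 := ler_wpM2r (normr_ge0 e2) (sin_lipschitz s t).
by rewrite /L; lra.
Qed.

Lemma ray_rotate t0 t : ray t = cos (t - t0) *: ray t0 + sin (t - t0) *: ray' t0.
Proof.
have hc : cos t = cos (t - t0) * cos t0 - sin (t - t0) * sin t0 by rewrite -cosD subrK.
have hs : sin t = sin (t - t0) * cos t0 + cos (t - t0) * sin t0 by rewrite -sinD subrK.
rewrite /ray /ray' hc hs !scalerDr !scalerA addrACA -!scalerDl.
by congr (_ *: _ + _ *: _); ring.
Qed.

Lemma support_ray_calm e : calm (fun t => phi (ray t) e).
Proof.
move=> t; have [C [delta [C0 delta0 h]]] := calm_of_quadratic phiP (quad (ray_neq0 t)).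
exists (C * L * `|e|), (delta / L); split.
- by rewrite !mulr_ge0 // ltW.
- by rewrite divr_gt0.
move=> s; rewrite ltr_pdivlMr // mulrC => st.
have := h (ray s) e (le_lt_trans (ray_lipschitz s t) st) => /le_trans; apply.
by rewrite [leRHS]mulrAC ler_wpM2r // -mulrA ler_wpM2l // ray_lipschitz.
Qed.

(** Divided by their cosines, [ray s] and [ray t] lie on the line through [ray t0] with direction
    [ray' t0], along which the derivative of the convex norm increases. The window of radius [1 / 4]
    keeps these cosines and [sin (t - s)] positive. *)
Lemma support_ray_mono t0 s t : t0 - 1 / 4 <= s -> s <= t -> t <= t0 + 1 / 4 ->
  phi (ray s) (ray' t0) <= phi (ray t) (ray' t0).
Proof.
move=> s0 st t1; have pi2 := pi_ge2 R.
have cpos x : t0 - 1 / 4 <= x <= t0 + 1 / 4 -> 0 < cos (x - t0).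
  by move=> hx; apply: cos_gt0_pihalf; lra.
have cs := cpos s (ltac:(lra)); have ct := cpos t (ltac:(lra)).
have E : cos (s - t0) *: ray t - cos (t - t0) *: ray s = sin (t - s) *: ray' t0.
  rewrite (ray_rotate t0 t) (ray_rotate t0 s); move: (ray t0) (ray' t0) => U U'.
  rewrite !scalerDr !scalerA opprD addrACA (mulrC (cos (t - t0)) (cos (s - t0))) subrr add0r -scalerBl; congr (_ *: _).
  have -> : t - s = (t - t0) - (s - t0) by lra.
  by rewrite [RHS]sinB; ring.
have h : 0 <= sin (t - s) * (phi (ray t) (ray' t0) - phi (ray s) (ray' t0)).
  rewrite mulrBr -!phiZ -E !phiB !phiZ !phiE.
  have h1 := ler_wpM2l (ltW ct) (phi_le (ray t) (ray s)).
  have h2 := ler_wpM2l (ltW cs) (phi_le (ray s) (ray t)).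
  by lra.
have [->|nst] := eqVneq s t; first exact: lexx.
have ss : 0 < sin (t - s) by apply: sin_gt0_pihalf; have : s < t by [rewrite lt_neqAle nst|]; lra.
by rewrite -subr_ge0 -(pmulr_rge0 _ ss).
Qed.

Lemma tangent_variation t0 : exists (F : R -> R) (K : R),
  [/\ {homo F : x y / x <= y}, calm F, 0 < K &
    forall s t, t0 - 1 / 4 <= s -> s <= t -> t <= t0 + 1 / 4 ->
      `|tangent t - tangent s| <= K * ((F t - F s) + (t - s))].
Proof.
pose k := clamp (t0 - 1 / 4) (t0 + 1 / 4).
have kin x : t0 - 1 / 4 <= k x <= t0 + 1 / 4 by apply: clamp_in; lra.
exists (fun t => phi (ray (k t)) (ray' t0)), (4 * (L + 1) * L); split.
- move=> x y xy; have /andP[h1 _] := clamp_mono (t0 - 1 / 4) (t0 + 1 / 4) xy.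
  have /andP[k1 _] := kin x; have /andP[_ k2] := kin y.
  by apply: support_ray_mono => //; rewrite /k; lra.
- move=> t; have [C [eta [C0 eta0 h]]] := support_ray_calm (ray' t0) (k t).
  exists C, eta; split=> // x xt.
  have kx := clamp_lipschitz (t0 - 1 / 4) (t0 + 1 / 4) x t; rewrite -/k in kx.
  by rewrite (le_trans (h _ (le_lt_trans kx xt))) // ler_wpM2l.
- by rewrite !mulr_gt0 // addr_gt0.
move=> s t s0 st t1; rewrite /k !clamp_id; try lra.
pose d e := phi (ray t) e - phi (ray s) e.
have dL a b x y : d (a *: x + b *: y) = a * d x + b * d y.
  by rewrite /d !phiD !phiZ; ring.
have dF : 0 <= d (ray' t0) by rewrite subr_ge0; exact: support_ray_mono.
(* Monotonicity controls only the component at [ray' t0]. The component along the ray is Lipschitz,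
   as [phi u u = |u|]. *)
have along : `|d (ray s)| <= 2 * (L * (t - s)).
  rewrite /d phiE; apply: (le_trans (support_near phiP _ _)); rewrite ler_pM2l //.
  by rewrite -[t - s]ger0_norm ?subr_ge0 //; exact: ray_lipschitz.
(* In the window [ray s] is mostly along [ray t0], so the bound at [ray s] can be solved for
   [d (ray t0)]. *)
have cb : 3 / 4 <= cos (s - t0).
  have := cos_lipschitz (s - t0) 0; rewrite cos0 subr0 !ler_norml => /andP[h _].
  have : `|s - t0| <= 1 / 4 by rewrite ler_norml; lra.
  by lra.
have sb : `|sin (s - t0)| <= 1 / 4.
  apply: (le_trans (_ : _ <= `|s - t0|)).
    by have := sin_lipschitz (s - t0) 0; rewrite sin0 !subr0.
  by rewrite ler_norml; lra.
have dray : d (ray s) = cos (s - t0) * d (ray t0) + sin (s - t0) * d (ray' t0).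
  by rewrite -dL -ray_rotate.
have d0 : `|d (ray t0)| <= 4 * L * (t - s) + d (ray' t0).
  have : `|cos (s - t0) * d (ray t0)| <= 2 * (L * (t - s)) + 1 / 4 * d (ray' t0).
    have -> : cos (s - t0) * d (ray t0) = d (ray s) - sin (s - t0) * d (ray' t0).
      by rewrite dray; ring.
    rewrite (le_trans (ler_normB _ _)) // lerD // normrM (ger0_norm dF).
    by rewrite ler_wpM2r.
  rewrite normrM ger0_norm; last by lra.
  have := ler_wpM2r (normr_ge0 (d (ray t0))) cb.
  have : 0 <= L * (t - s) by rewrite mulr_ge0 ?subr_ge0 // ltW.
  by lra.
have basis e : (e = e1 \/ e = e2) -> `|d e| <= 4 * L * (t - s) + 2 * d (ray' t0).
  have E1 : e1 = cos t0 *: ray t0 + - sin t0 *: ray' t0.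
    rewrite /ray /ray' !scalerDr !scalerA addrACA -!scalerDl.
    have -> : cos t0 * cos t0 + - sin t0 * - sin t0 = 1 by rewrite -(cos2Dsin2 t0); ring.
    have -> : cos t0 * sin t0 + - sin t0 * cos t0 = 0 by ring.
    by rewrite scale1r scale0r addr0.
  have E2 : e2 = sin t0 *: ray t0 + cos t0 *: ray' t0.
    rewrite /ray /ray' !scalerDr !scalerA addrACA -!scalerDl.
    have -> : sin t0 * sin t0 + cos t0 * cos t0 = 1 by rewrite -(cos2Dsin2 t0); ring.
    have -> : sin t0 * cos t0 + cos t0 * - sin t0 = 0 by ring.
    by rewrite scale1r scale0r add0r.
  have c1 : `|cos t0| <= 1 by rewrite ler_norml cos_geN1 cos_le1.
  have s1 : `|sin t0| <= 1 by rewrite ler_norml sin_geN1 sin_le1.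
  have b1 (c x : R) : `|c| <= 1 -> `|c * x| <= `|x| by move=> h; rewrite normrM ler_piMl.
  have dF' : `|d (ray' t0)| = d (ray' t0) by rewrite ger0_norm.
  have d1 : d e1 = cos t0 * d (ray t0) + - sin t0 * d (ray' t0) by rewrite -dL -E1.
  have d2 : d e2 = sin t0 * d (ray t0) + cos t0 * d (ray' t0). by rewrite -dL -E2.
  case=> ->; rewrite ?d1 ?d2.
    rewrite mulNr; apply: (le_trans (ler_normB _ _)).
    by have := b1 _ (d (ray t0)) c1; have := b1 _ (d (ray' t0)) s1; lra.
  apply: (le_trans (ler_normD _ _)).
  by have := b1 _ (d (ray t0)) s1; have := b1 _ (d (ray' t0)) c1; lra.
have b1 := basis e1 (or_introl erefl); have b2 := basis e2 (or_intror erefl).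
have -> : tangent t - tangent s = - d e2 *: e1 + d e1 *: e2.
  by rewrite /tangent /d opprD addrACA -!scalerBl; congr (_ *: _ + _ *: _); ring.
apply: (le_trans (ler_normD _ _)); rewrite !normrZ normrN -/(d (ray' t0)).
have st0 : 0 <= t - s by rewrite subr_ge0.
have big : 4 * L * (t - s) + 2 * d (ray' t0) <= 4 * (L + 1) * (d (ray' t0) + (t - s)).
  have := mulr_ge0 (ltW L0) st0; have := mulr_ge0 (ltW L0) dF; lra.
have c1 := ler_wpM2r (normr_ge0 e1) (le_trans b2 big).
have c2 := ler_wpM2r (normr_ge0 e2) (le_trans b1 big).
have -> : 4 * (L + 1) * L * (d (ray' t0) + (t - s)) =
   4 * (L + 1) * (d (ray' t0) + (t - s)) * `|e1| + 4 * (L + 1) * (d (ray' t0) + (t - s)) * `|e2|.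
  by rewrite {2}/L; ring.
by lra.
Qed.

Lemma norm_ray_le t : `|ray t| <= L.
Proof.
rewrite /ray (le_trans (ler_normD _ _)) // !normrZ lerD // ler_piMl //.
  by rewrite ler_norml cos_geN1 cos_le1.
by rewrite ler_norml sin_geN1 sin_le1.
Qed.

(** The coordinates of [tangent t] cannot both be small, because [|ray t|] is a combination of them
    with coefficients at most 1; the two uses of [coordinates_bound] give the constant [4 c^2]. *)
Lemma tangent_lower_bound : exists2 m : R, 0 < m & forall t, m <= `|tangent t|.
Proof.
have [c c0 hc] := coordinates_bound phiP ind.
have c20 : 0 < 4 * c ^+ 2 by rewrite mulr_gt0 // exprn_gt0.
exists (4 * c ^+ 2)^-1 => [|t]; first by rewrite invr_gt0.
have [cN sN] := hc (cos t) (sin t); rewrite -/(ray t) in cN sN.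
have [QT PT] := hc (- phi (ray t) e2) (phi (ray t) e1); rewrite -/(tangent t) normrN in QT PT.
have c1 : `|cos t| <= 1 by rewrite ler_norml cos_geN1 cos_le1.
have s1 : `|sin t| <= 1 by rewrite ler_norml sin_geN1 sin_le1.
have unit : 1 <= `|cos t| + `|sin t|.
  rewrite -(cos2Dsin2 t) -(real_normK (num_real (cos t))) -(real_normK (num_real (sin t))).
  by rewrite lerD // expr2 ler_piMl.
have N_le : `|ray t| <= 2 * c * `|tangent t|.
  rewrite -phiE {2}/ray phiD !phiZ.
  have h1 : cos t * phi (ray t) e1 <= `|phi (ray t) e1|.
    by rewrite (le_trans (ler_norm _)) // normrM ler_piMl.
  have h2 : sin t * phi (ray t) e2 <= `|phi (ray t) e2|.
    by rewrite (le_trans (ler_norm _)) // normrM ler_piMl.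
  by lra.
have := ler_wpM2l (ltW c0) N_le.
rewrite -[X in X <= `|_|]mul1r ler_pdivrMr //.
have -> : `|tangent t| * (4 * c ^+ 2) = 2 * (c * (2 * c * `|tangent t|)) by ring.
by lra.
Qed.

(** The norm lies between the support functional at [ray t] and the same plus a quadratic error. *)
Lemma is_derive_norm_ray (t : R) :
  is_derive t 1 (fun s => `|ray s|) (- sin t * phi (ray t) e1 + cos t * phi (ray t) e2).
Proof.
have [C [eta [C0 eta0 h]]] := quad (ray_neq0 t).
have CL : 0 <= C * L ^+ 2 by rewrite mulr_ge0 // exprn_ge0 // ltW.
apply: (@is_derive_second_order _ _
  (fun s => cos s * phi (ray t) e1 + sin s * phi (ray t) e2) (C * L ^+ 2) (eta / L) t) => //.
- by rewrite divr_gt0.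
- move=> s; rewrite ltr_pdivlMr // mulrC => st.
  have sray := ray_lipschitz s t.
  have := h (ray s - ray t) (le_lt_trans sray st).
  rewrite [ray t + _]addrC subrK phiB phiE => hs.
  have E : cos s * phi (ray t) e1 + sin s * phi (ray t) e2 = phi (ray t) (ray s).
    by rewrite {3}/ray phiD !phiZ.
  have sq : `|ray s - ray t| ^+ 2 <= (L * `|s - t|) ^+ 2.
    by rewrite ler_sqr ?nnegrE // mulr_ge0 // ltW.
  rewrite E ger0_norm ?subr_ge0 // -mulrA -exprMn.
  by have := ler_wpM2l C0 sq; lra.
- exact: (is_derive_vector (phi (ray t) e1) (phi (ray t) e2) (is_derive_cos t) (is_derive_sin t)).
Qed.

Let N t := `|ray t|.
(** The speed of the curve [ray t / N t], whose velocity is [tangent t / N t ^+ 2]. *)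
Let rho t := `|tangent t| / N t ^+ 2.
Let N0 t : 0 < N t. Proof. by rewrite normr_gt0 ray_neq0. Qed.
Let NE t : N t = cos t * phi (ray t) e1 + sin t * phi (ray t) e2.
Proof. by rewrite /N -phiE {2}/ray phiD !phiZ. Qed.

Lemma speed_continuous : continuous rho.
Proof.
have cP e := calm_continuous (support_ray_calm e).
have cN : continuous N.
  move=> t; apply: differentiable_continuous.
  by apply/derivable1_diffP; have [] := is_derive_norm_ray t.
move=> t; apply: cvgM.
  apply: cvg_norm; apply: cvgD; apply: cvgZr_tmp; last exact: cP.
  by apply: cvgN; exact: cP.
apply: cvgV; first by rewrite expf_neq0 // gt_eqF.
by apply: cvgM; exact: cN.
Qed.

(** In the quotient rule, the identity [NE] and [cos^2 + sin^2 = 1] collapse the numerators to the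
    coordinates of [tangent t]. *)
Lemma is_derive_polar (t : R) :
  is_derive t 1 (fun t => cos t / N t) (- phi (ray t) e2 / N t ^+ 2) /\
  is_derive t 1 (fun t => sin t / N t) (phi (ray t) e1 / N t ^+ 2).
Proof.
have dN := is_derive_norm_ray t; have nt := gt_eqF (N0 t); have cs := cos2Dsin2 t.
have n0 : N t != 0 by rewrite nt.
have dV := is_deriveV n0 dN.
set P := phi _ e1 in dN dV *; set Q := phi _ e2 in dN dV *.
split.
- have num : cos t * sin t * P - cos t ^+ 2 * Q - sin t * N t = - Q.
    by rewrite NE -[RHS]mulr1 -cs /P /Q; ring.
  have -> : - Q / N t ^+ 2 =
      cos t * (- N t ^- 2 * (- sin t * P + cos t * Q)) + (N t)^-1 * - sin t.
    by rewrite -num; field.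
  exact: (is_deriveM (is_derive_cos t) dV).
- have num : sin t ^+ 2 * P - cos t * sin t * Q + cos t * N t = P.
    by rewrite NE -[RHS]mulr1 -cs /P /Q; ring.
  have -> : P / N t ^+ 2 =
      sin t * (- N t ^- 2 * (- sin t * P + cos t * Q)) + (N t)^-1 * cos t.
    by rewrite -[in LHS]num; field.
  exact: (is_deriveM (is_derive_sin t) dV).
Qed.

Lemma normalize_lipschitz (a b : Z) : a != 0 -> b != 0 ->
  `| `|a|^-1 *: a - `|b|^-1 *: b| <= 2 * `|a - b| / `|a|.
Proof.
move=> a0 b0; have na : 0 < `|a| by rewrite normr_gt0.
have nb : 0 < `|b| by rewrite normr_gt0.
have -> : `|a|^-1 *: a - `|b|^-1 *: b =
    `|a|^-1 *: (a - b) + (`|a|^-1 * (`|b| - `|a|)) *: (`|b|^-1 *: b).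
  have -> : `|a|^-1 * (`|b| - `|a|) = `|a|^-1 * `|b| - 1 by field; rewrite gt_eqF.
  rewrite scalerBl scale1r scalerA -mulrA divff ?gt_eqF // mulr1 scalerBr.
  by rewrite addrA subrK.
apply: (le_trans (ler_normD _ _)); rewrite !normrZ ?normrM !normfV !normr_id.
rewrite mulVf ?gt_eqF // mulr1 -mulrDr mulrC ler_wpM2r ?invr_ge0 //.
by have := ler_dist_dist b a; rewrite (distrC b); lra.
Qed.

Lemma absolutely_smooth_of_quadratic : absolutely_smooth Z.
Proof.
have [m m0 hm] := tangent_lower_bound.
have L20 : 0 < L ^+ 2 by rewrite exprn_gt0.
pose c := m / L ^+ 2; have c0 : 0 < c by rewrite divr_gt0.
have crho t : c <= rho t.
  have N20 : 0 < N t ^+ 2 by rewrite exprn_gt0.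
  rewrite /c /rho; apply: ler_pM; rewrite ?invr_ge0 ?(ltW m0) ?(ltW L20) //.
  by rewrite lef_pV2 ?posrE // ler_sqr ?nnegrE ?(ltW L0) ?(ltW (N0 t)) // norm_ray_le.
have [l dl] := continuous_primitive speed_continuous.
have [k [dk kincr klip]] := derive_inverse c0 dl crho.
have tan0 t : 0 < `|tangent t| by apply: lt_le_trans (hm t).
pose r s := (cos (k s) / N (k s)) *: e1 + (sin (k s) / N (k s)) *: e2.
have rE s : r s = (N (k s))^-1 *: ray (k s).
  by rewrite /r /ray scalerDr !scalerA !(mulrC (N _)^-1).
pose T t := `|tangent t|^-1 *: tangent t.
have dr (s : R) : is_derive s 1 r (T (k s)).
  have [dc ds] := is_derive_polar (k s).
  have ca := is_derive1_comp dc (dk s); have cb := is_derive1_comp ds (dk s).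
  have -> : T (k s) = (- phi (ray (k s)) e2 / N (k s) ^+ 2 * (rho (k s))^-1) *: e1 +
      (phi (ray (k s)) e1 / N (k s) ^+ 2 * (rho (k s))^-1) *: e2.
    have t0 := tan0 (k s); have n0 := N0 (k s); rewrite /T /rho.
    rewrite {2}/tangent scalerDr !scalerA.
    by congr (_ *: _ + _ *: _); field; rewrite !gt_eqF.
  exact: (is_derive_vector e1 e2 ca cb).
have derive1_r (s : R) : derive1 r s = T (k s) by rewrite derive1E; have [_ ->] := dr s.
exists r; split.
- by move=> s; rewrite /unit_sphere /= rE normrZ gtr0_norm ?invr_gt0 // mulVf // gt_eqF.
- by move=> s; have [] := dr s.
- by move=> s; rewrite derive1_r normrZ gtr0_norm ?invr_gt0 // mulVf // gt_eqF.
move=> s0 _; have [F [K [ndF cF K0 hF]]] := tangent_variation (k s0).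
have c40 : 0 < c / 4 by rewrite divr_gt0.
(* Since [k] is [1 / c]-Lipschitz, the angle stays in the window of [tangent_variation] on this
   ball. *)
exists (ball s0 (c / 4)); split=> //; first exact: ball_open_nbhs.
have near_k s : ball s0 (c / 4) s -> k s0 - 1 / 4 <= k s <= k s0 + 1 / 4.
  rewrite /ball /= => sd.
  have ub x y : x <= y -> y - x <= c / 4 -> k y - k x <= 1 / 4.
    move=> xy yx; apply: (le_trans (klip _ _ xy)); rewrite ler_pdivrMr //; lra.
  have mono x y : x <= y -> k x <= k y.
    by rewrite le_eqVlt => /predU1P[->//|/kincr/ltW].
  have [s0s|/ltW ss0] := leP s0 s.
    have := ub _ _ s0s; have := mono _ _ s0s.
    by move: sd; rewrite distrC ger0_norm ?subr_ge0 // => sd h1 h2; have := h2 (ltW sd); lra.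
  have := ub _ _ ss0; have := mono _ _ ss0.
  by move: sd; rewrite ger0_norm ?subr_ge0 // => sd h1 h2; have := h2 (ltW sd); lra.
(* [K] bounds the variation of [tangent], and normalizing it costs a factor [2 / m]. *)
pose M := 2 * K / m; have M0 : 0 < M by rewrite divr_gt0 // mulr_gt0.
move=> eps eps0; pose e := eps / (2 * M).
have e0 : 0 < e by rewrite divr_gt0 // mulr_gt0.
have [d d0 hd] := calm_abs_continuous (k s0 - 1 / 4) (k s0 + 1 / 4) ndF cF e0.
(* The factor [c] converts arc length to angle; [d] makes the variation of [F] less than [e], and
   [e] bounds the variation of [k] itself. *)
exists (Num.min d e * c) => [|n a b hab hba]; first by rewrite mulr_gt0 // lt_min d0.
rewrite -ltr_pdivrMr // lt_min => /andP[sum1 sum2].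
have sumk : \sum_(i < n) (k (b i) - k (a i)) <= (\sum_(i < n) (b i - a i)) / c.
  rewrite mulr_suml; apply: ler_sum => i _; have [_ _ ab] := hab i (ltn_ord i).
  exact: klip (ltW ab).
have sumF : \sum_(i < n) (F (k (b i)) - F (k (a i))) < e.
  apply: (hd n (k \o a) (k \o b)) => [i ni|i ni|] /=.
  - have [Oa Ob ab] := hab i ni; split; last exact: kincr.
      by have /andP[] := near_k _ Oa.
    by have /andP[] := near_k _ Ob.
  - by apply: kincr; exact: hba.
  - exact: le_lt_trans sumk sum1.
apply: (@le_lt_trans _ _ (\sum_(i < n)
    M * ((F (k (b i)) - F (k (a i))) + (k (b i) - k (a i))))).
  apply: ler_sum => i _; have [Oa Ob ab] := hab i (ltn_ord i).
  have /andP[a1 _] := near_k _ Oa; have /andP[_ b1] := near_k _ Ob.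
  have := hF _ _ a1 (ltW (kincr _ _ ab)) b1; set v := _ + (k _ - k _) => hv.
  have tb := tan0 (k (b i)); have ta := tan0 (k (a i)).
  rewrite !derive1_r (le_trans (normalize_lipschitz _ _)) -?normr_gt0 //.
  rewrite ler_pdivrMr //; apply: (@le_trans _ _ (2 * (K * v))); first by rewrite ler_pM2l.
  have v0 : 0 <= K * v by apply: le_trans hv.
  have -> : 2 * (K * v) = M * v * m by rewrite /M; field; rewrite gt_eqF.
  rewrite ler_wpM2l //; rewrite pmulr_rge0 // in v0.
  by rewrite mulr_ge0 // ltW.
rewrite -mulr_sumr big_split /=.
have : \sum_(i < n) (k (b i) - k (a i)) < e by exact: le_lt_trans sumk sum2.
have eM : M * (e + e) = eps by rewrite /e; field; rewrite gt_eqF.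
by rewrite -eM ltr_pM2l // => h; exact: ltrD.
Qed.

End PolarCurve.

(** * Conclusion *)

Section Hypotheses.
Context {R : realType} {X : normedModType R}.

Lemma planar_of_dimension : has_dimension X 2 -> planar X.
Proof.
move=> [e he].
have sumE (c : 'rV[R]_2) : \sum_(i < 2) c 0 i *: e i = c 0 0 *: e 0 + c 0 1 *: e 1.
  by rewrite big_ord_recl big_ord1; congr (_ + c 0 _ *: e _); exact/val_inj.
apply: (@spanning_planar _ _ (e 0) (e 1)).
- move=> a b ab; have [c [_ cuniq]] := he 0.
  pose d : 'rV[R]_2 := \row_(i < 2) (if i == 0 then a else b).
  have d0 : 0 = \sum_(i < 2) d 0 i *: e i by rewrite sumE !mxE.
  have z0 : 0 = \sum_(i < 2) (0 : 'rV[R]_2) 0 i *: e i.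
    by rewrite sumE !mxE !scale0r addr0.
  have dz : d = 0 by rewrite -(cuniq _ d0) -(cuniq _ z0).
  have h0 : d 0 0 = 0 by rewrite dz mxE.
  have h1 : d 0 1 = 0 by rewrite dz mxE.
  by split; [move: h0|move: h1]; rewrite mxE.
- by move=> x; have [c [cx _]] := he x; exists (c 0 0), (c 0 1); rewrite -sumE.
Qed.

(** The face of the ball where the support functional at [a + b] equals 1 is a convex part of the
    sphere that contains both points. *)
Lemma midpoint_convex_of_strictly_convex (phi : X -> X -> R) :
  (forall u, supports (phi u) u) -> strictly_convex X -> midpoint_convex X.
Proof.
move=> phiP sc a b a1 b1 ab.
have [fL fE fle] := phiP (a + b); set f := phi (a + b) in fL fE fle.
have fab : f a + f b = 2 by rewrite -linear_formD // fE.
have := fle a; have := fle b; rewrite a1 b1 => fb fa.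
have fa1 : f a = 1 by lra.
have fb1 : f b = 1 by lra.
pose C := [set x : X | `|x| <= 1 /\ f x = 1].
have convC : convex_set C.
  apply/convex_setW => x y; rewrite !inE => -[x1 fx] [y1 fy] k k0 k1; rewrite inE.
  have h : `|k%:num *: x + (1 - k%:num) *: y| <= 1 /\ f (k%:num *: x + (1 - k%:num) *: y) = 1.
    split; last by rewrite linear_formC // fx fy; ring.
    rewrite (le_trans (ler_normD _ _)) // !normrZ gtr0_norm // gtr0_norm ?subr_gt0 //.
    have := ler_wpM2l (ltW k0) x1.
    by have := ler_wpM2l (ltW (ltac:(by rewrite subr_gt0) : 0 < 1 - k%:num)) y1; lra.
  exact: h.
apply: (sc C convC); [|by rewrite /C /= a1|by rewrite /C /= b1].
move=> x [x1 fx]; apply/eqP; rewrite eq_le x1 /=.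
by rewrite -fx; exact: fle.
Qed.

(** A support functional at [u] has its level set at 1 as a supporting hyperplane at the normalized
    point; uniqueness equates these level sets, and they determine the forms. *)
Lemma unique_supports_of_smooth : smooth_space X -> unique_supports X.
Proof.
move=> sm u f g u0 fu gu.
have nu : 0 < `|u| by rewrite normr_gt0.
pose v := `|u|^-1 *: u.
have v1 : `|v| = 1 by rewrite normrZ gtr0_norm ?invr_gt0 // mulVf // gt_eqF.
have [H [_ Huniq]] := sm v v1.
have hyper h : supports h u -> H = [set y | h y = 1] /\ h v = 1.
  move=> hP; have [hL hu hle] := hP.
  have hv : h v = 1 by rewrite linear_formZ // hu mulVf // gt_eqF.
  split=> //; apply: Huniq; split=> //.
  have lin : linear (h : X -> R^o) by move=> a x y; rewrite hL.
  pose F : {linear X -> R^o} := HB.pack (h : X -> R^o) (GRing.isLinear.Build R X R^o *:%R h lin).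
  exists F, 1; split=> //.
  - move=> x; apply/cvgrPdist_lt => eps eps0.
    apply/nbhs_ballP; exists eps => //= y; rewrite -ball_normE /= => xy.
    change (`|h x - h y| < eps); rewrite -linear_formB //.
    by apply: le_lt_trans xy; exact: (supports_norm _ hP).
  - by exists v; change (h v != 0); rewrite hv oner_neq0.
  - by move=> y; apply: le_trans; exact: hle.
have [Hf fv] := hyper f fu; have [Hg gv] := hyper g gu.
have fg x : f x = 1 -> g x = 1.
  by move=> fx; have : H x by [rewrite Hf|]; rewrite Hg.
have [fL _ _] := fu; have [gL _ _] := gu.
move=> x; have [fx|fx] := eqVneq (f x) 0.
  have := fg (v + x); rewrite !linear_formD // fx fv gv addr0 => /(_ erefl); lra.
have := fg ((f x)^-1 *: x); rewrite !linear_formZ // mulVf // => /(_ erefl) h.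
by apply: (mulfI (_ : (f x)^-1 != 0)); rewrite ?invr_neq0 // h mulVf.
Qed.

End Hypotheses.

Theorem theorem1p7 (R : realType) (X : completeNormedModType R)
    (dimX : has_dimension X 2)
    (scX : strictly_convex X)
    (smX : smooth_space X)
    (nasX : ~ absolutely_smooth X) :
  mazur_ulam_property X.
Proof.
have planarX := planar_of_dimension dimX.
have [phi phiP] := supports_exists planarX.
have mcX := midpoint_convex_of_strictly_convex phiP scX.
have gatX := gateaux_of_unique phiP planarX (unique_supports_of_smooth smX).
have [p0 [p00 nq0]] : exists p0 : X, p0 != 0 /\ ~ quadratic_at phi p0.
  apply: contrapT => no; apply: nasX; have [[e1 [e2 ind]] _] := planarX.
  apply: (absolutely_smooth_of_quadratic phiP _ ind) => v v0.
  by apply: contrapT => nq; apply: no; exists v.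
have np0 : 0 < `|p0| by rewrite normr_gt0.
pose p := `|p0|^-1 *: p0.
have p1 : `|p| = 1 by rewrite normrZ gtr0_norm ?invr_gt0 // mulVf // gt_eqF.
have nq : ~ quadratic_at phi p.
  move=> q; apply: nq0; have -> : p0 = `|p0| *: p by rewrite scalerA divff ?gt_eqF // scale1r.
  by apply: quadratic_scale => //; rewrite -normr_gt0 p1.
move=> Y f [fS fI].
have f_sphere x : `|x| = 1 -> `|f x| = 1.
  move=> x1; have : (f @` @unit_sphere R X) (f x) by exists x.
  by rewrite fS.
have f_isom x y : `|x| = 1 -> `|y| = 1 -> `|f x - f y| = `|x - y| by exact: fI.
have f_onto y : `|y| = 1 -> exists2 x, `|x| = 1 & f x = y.
  by move=> y1; have : @unit_sphere R Y y by []; rewrite -fS => -[x x1 fx]; exists x.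
have planarY := planar_transfer phiP planarX mcX f_sphere f_isom f_onto.
have mcY := midpoint_convex_transfer mcX f_sphere f_isom f_onto.
have [psi psiP] := supports_exists planarY.
have gatY := gateaux_transfer phiP gatX planarX mcX f_sphere f_isom f_onto psiP.
have f_odd := sphere_isometry_odd mcX f_sphere f_isom f_onto.
have [F [Fnorm Fonto Fs]] := linear_extension phiP psiP gatX gatY planarX planarY mcX mcY
  f_sphere f_isom f_onto f_odd p1 nq.
exists F; split=> [|s s1]; last exact: Fs.
split; last by move=> x y _ _; rewrite -raddfB Fnorm.
by apply/seteqP; split=> y // _; have [x Fx] := Fonto y; exists x.
Qed.
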